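(* Let $H>0$, $L>0$ and $0\le|a|<1$. Let $u_\varepsilon=(u_\varepsilon^{(1)},u_\varepsilon^{(2)})\in\mathcal{A}^1(a)$ (with $\varepsilon\to0$) satisfy $E^{1D}_\varepsilon(u_\varepsilon)\le C$ for a constant $C$ independent of $\varepsilon$. Then, up to extraction of subsequences, one has $u_\varepsilon^{(1)}\to u_1$ in $L^3(-H,H)$ for some function $u_1$ such that $u_1^3\in BV(-H,H)$, and one has $u_\varepsilon^{(2)}\to u_2$ in $C^{0,\gamma}$ for all $\gamma<1/2$. Furthermore, $|(u_1,u_2)|=1$ a.e. in $(-H,H)$.
   Context: $$\mathcal{A}^1(a)=\{u=u(y)\in H^1((-H,H);\mathbb{R}^2):\ u(\pm H)=(\pm\sqrt{1-a^2},a)\},$$ and for $u=(u_1,u_2)\in\mathcal{A}^1(a)$, $\varepsilon>0$, $$E^{1D}_\varepsilon(u)=\frac12\int_{-H}^H\Big\{\varepsilon|u'|^2+\frac1\varepsilon(|u|^2-1)^2+L(u_2')^2\Big\}\,dy.$$ *)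

(* Defs.v *)
From HB Require Import structures.
From mathcomp Require Import all_boot all_order all_algebra.
From mathcomp Require Import all_classical all_reals all_analysis.

Set Implicit Arguments.
Unset Strict Implicit.
Unset Printing Implicit Defensive.

Import Order.TTheory GRing.Theory Num.Theory.
Import numFieldNormedType.Exports.

Local Open Scope classical_set_scope.
Local Open Scope ring_scope.

(** Functions on ]a, b[ or [a, b] are total functions R -> R whose values
    outside the interval are irrelevant. *)
Section function_spaces.
Context {R : realType}.
Local Notation mu := (@lebesgue_measure R).
Implicit Types (a b gamma : R) (p : \bar R) (f g phi : R -> R).

(* L^p(a, b): the extension of f by 0 belongs to L^p(R). *)
Definition Lp_itv a b p f : Prop := (f \_ `]a, b[) \in Lfun mu p.

Definition Lp_norm a b p f : \bar R :=
  Lnorm mu p (EFin \o (f \_ `]a, b[)).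

(* C^1_c(a, b) *)
Definition C1c a b phi : Prop :=
  let supp := closure [set x | phi x != 0] in
  [/\ forall x, derivable phi x 1, continuous (derive1 phi),
      compact supp & supp `<=` `]a, b[].

Definition weak_derivative a b f g : Prop :=
  [/\ locally_integrable `]a, b[ f, locally_integrable `]a, b[ g &
      forall phi, C1c a b phi ->
        (\int[mu]_(x in `]a, b[) (f x * derive1 phi x) =
         - \int[mu]_(x in `]a, b[) (g x * phi x))%R].

(* A choice of weak derivative (unique up to a null set); junk if there is
   none. *)
Definition wderiv a b f : R -> R := get (weak_derivative a b f).

Definition H1 a b f : Prop :=
  Lp_itv a b 2%:E f /\ exists2 g, weak_derivative a b f g & Lp_itv a b 2%:E g.

(* BV(a, b): L^1 functions whose distributional derivative has finite total
   variation.  This is a notion on a.e. classes, unlike the pointwise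
   [bounded_variation]. *)
Definition BV_space a b f : Prop :=
  Lp_itv a b 1%:E f /\
  exists M : R, forall phi, C1c a b phi -> (forall x, `|phi x| <= 1) ->
    (\int[mu]_(x in `]a, b[) (f x * derive1 phi x) <= M)%R.

(* The norm of C^{0,gamma}(D), for D nonempty. *)
Definition holder_norm (D : set R) gamma f : \bar R :=
  (ereal_sup [set `|f x|%:E | x in D] +
   ereal_sup [set (`|f z.1 - f z.2| / `|z.1 - z.2| `^ gamma)%:E |
               z in [set z : R * R | [/\ D z.1, D z.2 & z.1 != z.2]]])%E.

End function_spaces.

Section energy.
Context {R : realType}.
Local Notation mu := (@lebesgue_measure R).
Implicit Types (H L a eps : R) (u : R -> R * R).

(* The norm of the library on [R * R] is the sup norm. *)
Definition enorm (v : R * R) : R := Num.sqrt (v.1 ^+ 2 + v.2 ^+ 2).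

Definition wderiv2 H u : R -> R * R := fun y =>
  (wderiv (- H) H (fst \o u) y, wderiv (- H) H (snd \o u) y).

(* An element of H^1((-H, H); R^2) is given by its continuous representative
   on [-H, H], through which its boundary values are defined. *)
Definition admissible H a u : Prop :=
  [/\ H1 (- H) H (fst \o u), H1 (- H) H (snd \o u),
      {within `[- H, H], continuous (fst \o u)} &
      {within `[- H, H], continuous (snd \o u)}] /\
  (u (- H) = (- Num.sqrt (1 - a ^+ 2), a) /\
   u H = (Num.sqrt (1 - a ^+ 2), a)).

Definition energy H L eps u : \bar R :=
  ((2^-1)%:E *
   \int[mu]_(y in `](- H)%R, H[)
     (eps * enorm (wderiv2 H u y) ^+ 2
      + eps^-1 * (enorm (u y) ^+ 2 - 1) ^+ 2
      + L * (wderiv2 H u y).2 ^+ 2)%:E)%E.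

End energy.

(* Main.v *)
Require Import Defs.
From mathcomp Require Import all_boot all_order all_algebra.
From mathcomp Require Import all_classical all_reals all_analysis.
From mathcomp Require Import measurable_realfun lra ring.
Import Order.TTheory GRing.Theory Num.Theory.
Import numFieldNormedType.Exports.
Local Open Scope classical_set_scope.
Local Open Scope ring_scope.

(** Set Q := |u|^2 - 1 and G := u1^3 / 3 - u1 (1 - u2^2), a primitive of Q in u1,
    so that u1^3 = - 3/2 (G - u1 Q).  The term L (u2')^2 bounds u2 in C^{0,1/2}, and
    Young's inequality |Q u1'| <= (eps u1'^2 + Q^2 / eps) / 2 shows that the increments
    of G along u are dominated by those of primitives of A e + B, where e is the
    energy density and A, B do not depend on eps.  Helly's theorem then makes G
    converge pointwise off a countable set, to a limit of bounded variation, and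
    Ascoli's theorem makes u2 converge uniformly.  As u1 Q tends to 0 in L^1,
    u1^3 converges in L^1, and |p - q|^3 <= 4 |p^3 - q^3| turns this into convergence
    of u1 in L^3. *)

(** No chain rule for Sobolev functions is used. A weak derivative g of f enters only through |f y -
    f x| <= integral of |g| over ]x, y[, and the potential is treated by exact finite differences,
    at a scale on which continuity brings secant slopes close to partial derivatives. At that stage
    no bound on u1 independent of eps is at hand, so the scale may shrink with eps; it leaves no
    trace, because local inequalities between increments add up. Where the size of u1 matters, u1^2
    <= 1 + |Q| replaces a sup bound. Domination of increments, |F y - F x| <= V y - V x, is the
    working notion of bounded variation: it survives pointwise limits, yields measurability and the
    distributional bound, and confines the failure of convergence to the jumps of the limit V. The
    fixed boundary value at - H turns bounds on increments into bounds on values. *)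

(** * Cutoff functions and uniform continuity *)

Definition smoothstep {R : realType} (t : R) : R :=
  2 * (Num.max 0 t ^+ 2 - 2 * Num.max 0 (t - 2^-1) ^+ 2 + Num.max 0 (t - 1) ^+ 2).

(** Truncated powers give a cheap C^1 cutoff, which is all that [C1c] asks. [hat] is the derivative
    of [smoothstep]: the tent on [0, 1] with peak 2 at 1/2, hence of mass 1. *)
Definition hat {R : realType} (t : R) : R :=
  4 * (Num.max 0 t - 2 * Num.max 0 (t - 2^-1) + Num.max 0 (t - 1)).

Lemma is_derive_pos_part_sqr {R : realType} (c x : R) :
  is_derive x 1 (fun t : R => Num.max 0 (t - c) ^+ 2) (2 * Num.max 0 (x - c)).
Proof.
have cv : (fun h : R => h^-1 *: (Num.max 0 (h + x - c) ^+ 2 - Num.max 0 (x - c) ^+ 2))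
    @ 0^' --> 2 * Num.max 0 (x - c).
  apply/cvgrPdist_le => /= e e0.
  near=> h.
  have hn0 : h != 0 by near: h; exact: nbhs_dnbhs_neq.
  have he : `|h| <= e.
    near: h; apply: dnbhs0_le; exact: e0.
  have -> : 2 * Num.max 0 (x - c) - h^-1 *: (Num.max 0 (h + x - c) ^+ 2 - Num.max 0 (x - c) ^+ 2)
    = h^-1 * (2 * Num.max 0 (x - c) * h - Num.max 0 (h + x - c) ^+ 2 + Num.max 0 (x - c) ^+ 2).
    by rewrite /GRing.scale /=; field.
  rewrite normrM normfV ler_pdivrMl ?normr_gt0//.
  (* The first-order remainder of a squared positive part is at most h^2 in each of the four sign
     cases, so the quotient is within |h| of its limit. *)
  apply: (@le_trans _ _ (`|h| * `|h|)); last by rewrite ler_wpM2l.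
  rewrite -normrM -expr2 [leRHS]ger0_norm ?sqr_ge0//.
  rewrite ler_norml; case: (lerP 0 (x - c)) => h1; case: (lerP 0 (h + x - c)) => h2; apply/andP; split; nra.
have D : derivable (fun t : R => Num.max 0 (t - c) ^+ 2) x 1.
  apply/cvg_ex; exists (2 * Num.max 0 (x - c)).
  apply: cvg_trans cv; apply: near_eq_cvg; near=> h => /=.
  by rewrite /GRing.scale /= mulr1.
apply: DeriveDef => //.
rewrite /derive; apply/cvg_lim => //.
apply: cvg_trans cv; apply: near_eq_cvg; near=> h => /=.
by rewrite /GRing.scale /= mulr1.
Unshelve. all: by end_near. Qed.

Lemma is_derive_smoothstep {R : realType} (h c x : R) :
  is_derive x 1 (fun t : R => smoothstep (h * (t - c))) (h * hat (h * (x - c))).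
Proof.
have D := is_derive_pos_part_sqr.
have D0 (y : R) : is_derive y 1 (fun t : R => Num.max 0 t ^+ 2) (2 * Num.max 0 y).
  by have := D R 0 y; under eq_fun do rewrite subr0; rewrite subr0.
have DS (y : R) : is_derive y 1 (smoothstep : R -> R) (hat y).
  rewrite /smoothstep.
  apply: is_derive_eq; rewrite /hat /GRing.scale /=; ring.
have D1 : is_derive x 1 (fun t : R => h * (t - c)) h.
  by apply: is_derive_eq; rewrite /GRing.scale /=; ring.
have := @is_derive1_comp R smoothstep (fun t => h * (t - c)) x _ _ (DS _) D1.
by rewrite mulrC.
Qed.

Lemma hat_ge0 {R : realType} (t : R) : 0 <= hat t.
Proof.
rewrite /hat; case: (lerP 0 t) => ?; case: (lerP 0 (t - 2^-1)) => ?;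
  case: (lerP 0 (t - 1)) => ?; lra.
Qed.

Lemma hat_eq0 {R : realType} (t : R) : t <= 0 \/ 1 <= t -> hat t = 0.
Proof.
rewrite /hat => -[?|?]; case: (lerP 0 t) => ?; case: (lerP 0 (t - 2^-1)) => ?;
  case: (lerP 0 (t - 1)) => ?; lra.
Qed.

Lemma smoothstep_eq0 {R : realType} (t : R) : t <= 0 -> smoothstep t = 0.
Proof.
rewrite /smoothstep => ?; case: (lerP 0 t) => ?; case: (lerP 0 (t - 2^-1)) => ?;
  case: (lerP 0 (t - 1)) => ?; nra.
Qed.

Lemma smoothstep_eq1 {R : realType} (t : R) : 1 <= t -> smoothstep t = 1.
Proof.
rewrite /smoothstep => ?; case: (lerP 0 t) => ?; case: (lerP 0 (t - 2^-1)) => ?;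
  case: (lerP 0 (t - 1)) => ?; try lra; field.
Qed.

Lemma smoothstep_itv01 {R : realType} (t : R) : 0 <= smoothstep t <= 1.
Proof.
rewrite /smoothstep; case: (lerP 0 t) => ?; case: (lerP 0 (t - 2^-1)) => ?;
  case: (lerP 0 (t - 1)) => ?; apply/andP; split; nra.
Qed.

Lemma continuous_hat {R : realType} : continuous (hat : R -> R).
Proof.
have cm (c : R) : continuous (fun t : R => Num.max 0 (t - c)).
  move=> t; apply: (@continuous_max R R (cst 0) (fun t => t - c) t); first exact: cvg_cst.
  by apply: cvgB; [exact: cvg_id|exact: cvg_cst].
have cm0 : continuous (fun t : R => Num.max 0 t).
  by have := cm 0; under eq_fun do rewrite subr0.
move=> t; apply: cvgM; first exact: cvg_cst.
apply: cvgD; last exact: cm.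
apply: cvgB; first exact: cm0.
by apply: cvgM; [exact: cvg_cst|exact: cm].
Qed.

(** Heine's theorem through near-coverings: the radius runs along [0^'+], and half of the local
    radius of continuity absorbs the displacement from a center to a nearby point. *)
Lemma within_continuous_itv_uniform {R : realType} {a b : R} {f : R -> R} :
  {within `[a, b], continuous f} ->
  forall e, 0 < e -> exists2 d, 0 < d &
    {in `[a, b] &, forall x y, `|x - y| < d -> `|f x - f y| < e}.
Proof.
move=> cf e e0; have e20 : 0 < e / 2 by rewrite divr_gt0.
have /compact_near_coveringP := @segment_compact R a b.
move=> /(_ R (0^'+) (fun d (x : R) => x \in `[a, b] -> forall y, y \in `[a, b] -> `|x - y| < d ->
  `|f x - f y| < e)) H.
have {}H : \forall d \near 0^'+, `[a, b] `<=` (fun x : R => x \in `[a, b] -> forall y, y \in `[a, b] ->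
  `|x - y| < d -> `|f x - f y| < e).
  apply: H.
  move=> x abx.
  have /cvgrPdist_lt /= := (subspace_continuousP _ _).1 cf x abx.
  move=> /(_ (e / 2)) /(_ e20).
  rewrite near_withinE => -[d /= d0 xd].
  exists (ball x (d / 2), [set r | 0 < r < d / 2]) => /=.
    split; first by exists (d / 2) => //=; rewrite divr_gt0.
    near=> r; apply/andP; split => //; near: r; apply: nbhs_right_lt; rewrite divr_gt0 //.
  move=> -[x' r] /= [xx' /andP[r0 rd]] abx' y aby x'y.
  have h1 : `|f x - f x'| < e / 2 by apply: xd => //=; rewrite (lt_trans xx')//; lra.
  have h2 : `|f x - f y| < e / 2.
    apply: xd => //=; rewrite (le_lt_trans (ler_distD x' _ _))//.
    rewrite /ball /= in xx'; lra.
  rewrite (le_lt_trans (ler_distD (f x) _ _))// distrC; lra.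
have : \forall d \near 0^'+, 0 < d /\ `[a, b] `<=` (fun x : R => x \in `[a, b] -> forall y, y \in `[a, b] ->
  `|x - y| < d -> `|f x - f y| < e).
  near=> d; split => //; near: d; exact: H.
move=> /filter_ex [d [d0 dP]]; exists d => // x y xab yab; exact: dP.
Unshelve. all: by end_near. Qed.

(** * Integrals over open intervals and averaging kernels *)

Section open_interval_integrals.
Context {R : realType}.
Local Notation mu := (@lebesgue_measure R).
Implicit Types (a b c k l x y e : R) (f g : R -> R).

Lemma integrable_oo_continuous a b f : {within `[a, b], continuous f} ->
  mu.-integrable `]a, b[ (EFin \o f).
Proof.
move=> cf; apply: (@integrableS _ _ _ mu `[a, b]%classic) => //.
  exact: subset_itv_oo_cc.
by apply: continuous_compact_integrable => //; exact: segment_compact.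
Qed.

Lemma continuous_scaled_hat k l : continuous (fun t : R => k * hat (k * (t - l))).
Proof.
move=> t; apply: cvgM; first exact: cvg_cst.
apply: (@continuous_comp _ _ _ (fun t => k * (t - l)) hat); last exact: continuous_hat.
by apply: cvgM; [exact: cvg_cst | apply: cvgB; [exact: cvg_id|exact: cvg_cst]].
Qed.

Lemma Rintegral_derive1 a b f : a < b -> (forall x, derivable f x 1) ->
  continuous (derive1 f) -> \int[mu]_(t in `]a, b[) derive1 f t = f b - f a.
Proof.
move=> ab df cf.
have cwf : {within `[a, b], continuous (derive1 f)} by exact: continuous_subspaceT.
have cc x : {for x, continuous f} by exact/differentiable_continuous/derivable1_diffP.
rewrite Rintegral_itv_obnd_cbnd; last exact: integrable_oo_continuous.
rewrite Rintegral_itv_bndo_bndc; last first.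
  apply: (@integrableS _ _ _ mu `[a, b]%classic) => //.
    by apply: subset_itvl; rewrite bnd_simp.
  by apply: continuous_compact_integrable => //; exact: segment_compact.
have L : derivable_oo_LRcontinuous f a b.
  by split => [x _||]; [exact: df|exact/cvg_at_right_filter/cc|exact/cvg_at_left_filter/cc].
by rewrite /Rintegral (continuous_FTC2 ab cwf L).
Qed.

Lemma Rintegral_hat a b l k : 0 < k -> a <= l -> l + k^-1 <= b ->
  \int[mu]_(t in `]a, b[) (k * hat (k * (t - l))) = 1.
Proof.
move=> k0 al lb.
have ab : a < b.
  by apply: lt_le_trans lb; rewrite (le_lt_trans al)// ltrDl invr_gt0.
have E : derive1 (fun t => smoothstep (k * (t - l)) : R) = fun t => k * hat (k * (t - l)).
  by apply/funext => x; rewrite derive1E; have [_ ->] := is_derive_smoothstep k l x.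
have dS x : derivable (fun t => smoothstep (k * (t - l)) : R) x 1.
  by have [] := is_derive_smoothstep k l x.
have cS : continuous (derive1 (fun t => smoothstep (k * (t - l)) : R)).
  by rewrite E; exact: continuous_scaled_hat.
rewrite -E (Rintegral_derive1 _ _ _ ab dS cS) smoothstep_eq1 ?smoothstep_eq0 ?subr0//.
  by rewrite pmulr_rle0// subr_le0.
by rewrite -ler_pdivrMl// mulr1; lra.
Qed.

Lemma within_continuousM a b f g : {within `[a, b], continuous f} ->
  {within `[a, b], continuous g} -> {within `[a, b], continuous (fun t => f t * g t)}.
Proof. by move=> cf cg x; apply: cvgM; [exact: cf|exact: cg]. Qed.

(** The scaled hat is a probability density supported in [l, l + 1/k], so only the behaviour of f on
    that window matters. *)
Lemma Rintegral_hat_average a b f l k c e : 0 < k -> a <= l -> l + k^-1 <= b ->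
  {within `[a, b], continuous f} ->
  (forall t, l <= t <= l + k^-1 -> `|f t - c| <= e) ->
  `|\int[mu]_(t in `]a, b[) (f t * (k * hat (k * (t - l)))) - c| <= e.
Proof.
move=> k0 al lb cf fce.
set K := fun t => k * hat (k * (t - l)).
have cK : {within `[a, b], continuous K} by apply/continuous_subspaceT/continuous_scaled_hat.
have iK r : mu.-integrable `]a, b[ (EFin \o (fun t => r * K t)).
  by apply: integrable_oo_continuous; apply: within_continuousM => // ?; exact: cvg_cst.
have ifK : mu.-integrable `]a, b[ (EFin \o (fun t => f t * K t)).
  by apply: integrable_oo_continuous; exact: within_continuousM.
have K1 : \int[mu]_(t in `]a, b[) K t = 1 by exact: Rintegral_hat.
have iK1 : mu.-integrable `]a, b[ (EFin \o K) by exact: integrable_oo_continuous.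
have cE r : \int[mu]_(t in `]a, b[) (r * K t) = r.
  by rewrite RintegralZl// K1 mulr1.
rewrite -[X in _ - X](cE c) -RintegralB//.
apply: le_trans; first apply: le_normr_Rintegral => //.
  have := @integrableB _ _ R mu `]a, b[ _ _ _ ifK (iK c).
  exact.
rewrite -[leRHS](cE e); apply: le_Rintegral => //.
  apply: integrable_norm.
  have := @integrableB _ _ R mu `]a, b[ _ _ _ ifK (iK c).
  exact.
move=> t _; rewrite -mulrBl normrM.
have K0 : 0 <= K t by rewrite mulr_ge0 ?hat_ge0// ltW.
rewrite (ger0_norm K0).
have [lt|lt] := boolP (l <= t <= l + k^-1).
  by rewrite ler_wpM2r// fce.
suff -> : K t = 0 by rewrite !mulr0.
rewrite /K hat_eq0 ?mulr0//.
move: lt; rewrite negb_and -!ltNge => /orP[tl|lt].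
  by left; rewrite pmulr_rle0// subr_le0 ltW.
by right; rewrite -ler_pdivrMl// mulr1; lra.
Qed.

End open_interval_integrals.

(** * Increments of a function with a weak derivative *)

Section weak_derivative.
Context {R : realType}.
Local Notation mu := (@lebesgue_measure R).
Implicit Types (a b k l m x y e : R) (f g : R -> R).

(** Two ramps, with value 1 between them when l + 1/k <= m. The derivative is an averaging kernel
    near l minus one near m, so this test function compares the values of f near l and near m. *)
Definition plateau k l m : R -> R :=
  fun t => smoothstep (k * (t - l)) - smoothstep (k * (t - m)).

Lemma is_derive_plateau k l m x :
  is_derive x 1 (plateau k l m) (k * hat (k * (x - l)) - k * hat (k * (x - m))).
Proof.
have Dl := is_derive_smoothstep k l x; have Dm := is_derive_smoothstep k m x.
exact: is_deriveB.
Qed.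

Lemma plateau_eq0 k l m x : 0 < k -> l <= m -> ~~ (l <= x <= m + k^-1) ->
  plateau k l m x = 0.
Proof.
move=> k0 lm; rewrite negb_and -!ltNge /plateau => /orP[xl|mx].
  by rewrite !smoothstep_eq0 ?subrr// pmulr_rle0//; lra.
by rewrite !smoothstep_eq1 ?subrr// -ler_pdivrMl// mulr1; lra.
Qed.

Lemma normr_plateau_le1 k l m x : `|plateau k l m x| <= 1.
Proof.
have /andP[? ?] := smoothstep_itv01 (k * (x - l)).
have /andP[? ?] := smoothstep_itv01 (k * (x - m)).
rewrite /plateau ler_norml; apply/andP; split; lra.
Qed.

Lemma C1c_plateau a b k l m : 0 < k -> l <= m -> a < l -> m + k^-1 < b ->
  C1c a b (plateau k l m).
Proof.
move=> k0 lm al mb.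
have sub : closure [set x | plateau k l m x != 0] `<=` `[l, m + k^-1].
  rewrite closureE; apply: smallest_sub; first exact: itv_closed.
  move=> x /=; apply: contraNT; rewrite in_itv /= => ?.
  by rewrite plateau_eq0.
split.
- by move=> x; have [] := is_derive_plateau k l m x.
- have -> : derive1 (plateau k l m) = fun x => k * hat (k * (x - l)) - k * hat (k * (x - m)).
    by apply/funext => x; rewrite derive1E; have [_ ->] := is_derive_plateau k l m x.
  by move=> x; apply: cvgB; exact: continuous_scaled_hat.
- apply: subclosed_compact sub; first exact: closed_closure.
  exact: segment_compact.
- apply: subset_trans sub _ => x /=; rewrite !in_itv /= => /andP[lx xm].
  by rewrite (lt_le_trans al)// (le_lt_trans xm).
Qed.

Lemma Rintegral_oo_subset a b x y f : a <= x -> y <= b ->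
  mu.-integrable `]a, b[ (EFin \o f) ->
  \int[mu]_(t in `]x, y[) f t = \int[mu]_(t in `]a, b[) (f \_ `]x, y[) t.
Proof.
move=> ax yb fi; rewrite -Rintegral_mkcondr; congr (Rintegral _ _ _).
apply/esym/setIidPr; apply: subset_itv; by rewrite bnd_simp.
Qed.

(** A plateau bounded by 1 and supported in ]x, y[ is used as test function: one side of the weak
    formulation becomes a difference of averages of f near x and near y, the other is at most the
    integral of |g|. *)
Lemma weak_derivative_increment a b f g x y :
  {within `[a, b], continuous f} -> weak_derivative a b f g ->
  mu.-integrable `]a, b[ (EFin \o g) -> a <= x -> x < y -> y <= b ->
  `|f y - f x| <= \int[mu]_(t in `]x, y[) `|g t|.
Proof.
move=> cf [_ _ fg] gi ax xy yb.
apply/ler_addgt0Pl => e e0.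
have e20 : 0 < e / 2 by rewrite divr_gt0.
have [d d0 fd] := within_continuous_itv_uniform cf _ e20.
(* [h <= d / 3] keeps the windows [x + h, x + 2h] and [y - 2h, y - h] within d of x and y;
   [h <= (y - x) / 4] keeps them in order. The gap h at each end puts the support inside ]a, b[ even
   if x = a or y = b. *)
pose h := Num.min (d / 3) ((y - x) / 4).
have h0 : 0 < h by rewrite lt_min !divr_gt0// subr_gt0.
have hd : h <= d / 3 by rewrite ge_min lexx.
have hxy : h <= (y - x) / 4 by rewrite ge_min lexx orbT.
pose k := h^-1; have k0 : 0 < k by rewrite invr_gt0.
have kh : k^-1 = h by rewrite invrK.
pose phi := plateau k (x + h) (y - 2 * h).
have C : C1c a b phi by apply: C1c_plateau => //; rewrite ?kh; lra.
have D1 t : derive1 phi t = k * hat (k * (t - (x + h))) - k * hat (k * (t - (y - 2 * h))).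
  by rewrite derive1E; have [_ ->] := is_derive_plateau k (x + h) (y - 2 * h) t.
have cK l : {within `[a, b], continuous (fun t => k * hat (k * (t - l)))}.
  exact/continuous_subspaceT/continuous_scaled_hat.
have ifK l : mu.-integrable `]a, b[ (EFin \o (fun t => f t * (k * hat (k * (t - l))))).
  by apply: integrable_oo_continuous; exact: within_continuousM.
have E : \int[mu]_(t in `]a, b[) (f t * derive1 phi t) =
    \int[mu]_(t in `]a, b[) (f t * (k * hat (k * (t - (x + h))))) -
    \int[mu]_(t in `]a, b[) (f t * (k * hat (k * (t - (y - 2 * h))))).
  rewrite -RintegralB//; apply: eq_Rintegral => t _.
  by rewrite D1 mulrBr.
have Ax : `|\int[mu]_(t in `]a, b[) (f t * (k * hat (k * (t - (x + h))))) - f x| <= e / 2.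
  apply: Rintegral_hat_average => //; rewrite ?kh; try lra.
  move=> t /andP[? ?]; apply/ltW/fd; rewrite ?in_itv /=; try (apply/andP; split; lra).
  by rewrite ltr_norml; apply/andP; split; lra.
have Ay : `|\int[mu]_(t in `]a, b[) (f t * (k * hat (k * (t - (y - 2 * h))))) - f y| <= e / 2.
  apply: Rintegral_hat_average => //; rewrite ?kh; try lra.
  move=> t /andP[? ?]; apply/ltW/fd; rewrite ?in_itv /=; try (apply/andP; split; lra).
  by rewrite ltr_norml; apply/andP; split; lra.
have cphi : continuous phi.
  move=> t; apply/differentiable_continuous/derivable1_diffP.
  by have [] := is_derive_plateau k (x + h) (y - 2 * h) t.
have igp : mu.-integrable `]a, b[ (EFin \o (fun t => g t * phi t)).
  have gm := measurable_int _ gi.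
  apply: (le_integrable _ _ _ gi) => //.
    apply/measurable_EFinP/measurable_funM; first exact/measurable_EFinP.
    apply: measurable_funTS; exact: continuous_measurable_fun.
  by move=> t _ /=; rewrite lee_fin normrM ler_piMr// normr_plateau_le1.
have iag : mu.-integrable `]a, b[ (EFin \o (fun t => `|g t|)) by exact: integrable_norm.
have B : `|\int[mu]_(t in `]a, b[) (g t * phi t)| <= \int[mu]_(t in `]x, y[) `|g t|.
  apply: le_trans; first exact: le_normr_Rintegral.
  rewrite (Rintegral_oo_subset _ _ _ _ _ ax yb iag); apply: le_Rintegral => //.
  - exact: integrable_norm.
  - rewrite -restrict_EFin; apply/integrable_restrict => //.
    by apply: integrableS iag => //; exact: measurableI.
  - move=> t _; rewrite patchE; case: ifPn => txy.
      by rewrite normrM ler_piMr// normr_plateau_le1.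
    rewrite /phi plateau_eq0 ?mulr0 ?normr0// ?kh; first lra.
    apply: contra txy => /andP[? ?]; rewrite inE /= in_itv /=.
    by apply/andP; split; lra.
have := fg _ C; rewrite E => EE.
move: Ax Ay B; rewrite !ler_norml => /andP[? ?] /andP[? ?] /andP[? ?].
by apply/andP; split; lra.
Qed.

End weak_derivative.

(** Cut [x, y] into steps of length d/2 and add up by the triangle inequality. The threshold d is
    absent from the conclusion, so it may depend on the functions at hand. *)
Lemma increment_chain {R : realType} (a b d : R) (F W : R -> R) : 0 < d ->
  (forall x y, a <= x -> x < y -> y <= b -> y - x < d -> `|F y - F x| <= W y - W x) ->
  forall x y, a <= x -> x <= y -> y <= b -> `|F y - F x| <= W y - W x.
Proof.
move=> d0 loc x y ax xy yb.
have [n hn] : exists n : nat, y - x < n%:R * (d / 2).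
  have d20 : 0 < d / 2 by rewrite divr_gt0.
  exists (Num.truncn ((y - x) / (d / 2))).+1.
  by rewrite -ltr_pdivrMr// truncnS_gt.
elim: n y xy yb hn => [|n IH] y xy yb hn.
  by move: hn; rewrite mul0r; lra.
move: xy; rewrite le_eqVlt => /predU1P[->|xy]; first by rewrite !subrr normr0.
have [yxd|yxd] := ltP (y - x) d; first exact: loc.
have hn' : y - d / 2 - x < n%:R * (d / 2) by move: hn; rewrite -natr1; lra.
have h1 : `|F (y - d / 2) - F x| <= W (y - d / 2) - W x by apply: IH => //; lra.
have h2 : `|F y - F (y - d / 2)| <= W y - W (y - d / 2) by apply: loc; lra.
have := ler_distD (F (y - d / 2)) (F y) (F x); lra.
Qed.

(** * Extraction of subsequences: Helly and Ascoli *)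

(** Compactness of [- M, M] gives a cluster point; an ultrafilter contains each preimage or its
    complement, so the cluster point is a limit. *)
Lemma ultrafilter_bounded_cvg {R : realType} (U : set_system nat) (f : nat -> R) (M : R) :
  UltraFilter U -> (forall n, `|f n| <= M) -> exists l : R, f n @[n --> U] --> l.
Proof.
move=> UU fM.
have fA : (f @ U) `[- M, M]%classic.
  rewrite /fmap /=; apply: filterS filterT => n _.
  by rewrite /= in_itv /= -ler_norml.
have [l [_ lc]] := @segment_compact R (- M) M (f @ U) _ fA.
exists l => V lV.
have [//|nV] := in_ultra_setVsetC (f @^-1` V) UU.
by have [x [nVx Vx]] := lc (~` V) V nV lV.
Qed.

(** The limit g is taken along an ultrafilter, so it exists at every point of T, countable or not;
    the subsequence follows it only along the family q. The last clause lets non-strict inequalities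
    between values at finitely many points pass from the f n to g. *)
Lemma pointwise_extraction {R : realType} {T : eqType} (f : nat -> T -> R) (M : T -> R) (q : nat -> T) :
  (forall n t, `|f n t| <= M t) ->
  exists (g : T -> R) (k : nat -> nat), [/\ {homo k : m n / (m < n)%N},
    forall i, f (k m) (q i) @[m --> \oo] --> g (q i) &
    forall (s : seq T) e, 0 < e -> exists n, {in s, forall t, `|f n t - g t| < e}].
Proof.
move=> fM.
have [U [UU ooU]] := @ultraFilterLemma nat \oo _.
have /choice[g fg] : forall t, exists l : R, f n t @[n --> U] --> l.
  by move=> t; apply: ultrafilter_bounded_cvg => n; exact: fM.
have gU (s : seq T) e : 0 < e -> U [set n | {in s, forall t, `|f n t - g t| < e}].
  move=> e0; elim: s => [|t s IH].
    by apply: filterS filterT => n _ t; rewrite in_nil.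
  have /cvgrPdist_lt/(_ _ e0) Ut := fg t.
  near=> n => t'; rewrite in_cons => /orP[/eqP ->|].
    by rewrite distrC; near: n.
  by move: t'; near: n.
have /choice[h hP] : forall p : nat * nat, exists n, (p.2 < n)%N /\
    {in map q (iota 0 p.1.+1), forall t, `|f n t - g t| < p.1.+1%:R^-1}.
  move=> [m N]; apply: (@filter_ex _ U) => /=.
  apply: filterI; first by apply: ooU; exists N.+1.
  by apply: gU; rewrite invr_gt0.
(* [h (m, N)] is an index beyond N at which the first m + 1 points of q are approximated to within 1
   / (m + 1). *)
pose k := fix k m := if m is m'.+1 then h (m, k m') else h (0%N, 0%N).
have kP m : {in map q (iota 0 m.+1), forall t, `|f (k m) t - g t| < m.+1%:R^-1}.
  by case: m => [|m] /=; [have [] := hP (0%N, 0%N)|have [] := hP (m.+1, k m)].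
exists g, k; split.
- by apply: homo_ltn => [? ? ?|m /=]; [exact: ltn_trans|have [] := hP (m.+1, k m)].
- move=> i; apply/cvgrPdist_lt => /= e e0; near=> m.
  have im : (i <= m)%N by near: m; exact: nbhs_infty_ge.
  rewrite distrC; apply: (lt_trans (kP m _ _)).
    by apply: map_f; rewrite mem_iota add0n ltnS.
  rewrite invf_plt ?posrE//.
  have em : (Num.truncn e^-1 <= m)%N by near: m; exact: nbhs_infty_ge.
  by rewrite (lt_le_trans (truncnS_gt _))// ler_nat ltnS.
- by move=> s e e0; apply: (@filter_ex _ U); exact: gU.
Unshelve. all: by end_near. Qed.

(** Monotonicity supplies both one-sided limits, which coincide when x is not a discontinuity. The
    bracket is rational because Helly's extraction converges a priori only on an enumerated set. *)
Lemma nondecreasing_bracket {R : realType} (a b x : R) (W : R -> R) :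
  {in `[a, b] &, {homo W : s t / s <= t}} -> a < x < b -> ~ discontinuity W x ->
  forall e, 0 < e -> exists p q : rat,
    [/\ a < ratr p < x, x < ratr q < b & W (ratr q) - W (ratr p) < e].
Proof.
move=> ndW /andP[ax xb] ndx e e0.
have abx : x \in `[a, b] by rewrite in_itv /= !ltW.
have cl : cvg (W t @[t --> x^'-]).
  apply: nondecreasing_at_left_is_cvgr; near=> s;
    have as_ : a < s by near: s; exact: nbhs_left_gt.
    move=> u v; rewrite !in_itv /= => /andP[su ux] /andP[sv vx] uv.
    by apply: ndW => //; rewrite in_itv /=; apply/andP; split; lra.
  exists (W x) => _ /= [t + <-]; rewrite in_itv /= => /andP[st tx].
  by apply: ndW => //; rewrite ?in_itv /=; first apply/andP; lra.
have cr : cvg (W t @[t --> x^'+]).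
  apply: nondecreasing_at_right_is_cvgr; near=> s;
    have sb : s < b by near: s; exact: nbhs_right_lt.
    move=> u v; rewrite !in_itv /= => /andP[xu us] /andP[xv vs] uv.
    by apply: ndW => //; rewrite in_itv /=; apply/andP; split; lra.
  exists (W x) => _ /= [t + <-]; rewrite in_itv /= => /andP[xt ts].
  by apply: ndW => //; rewrite ?in_itv /=; first apply/andP; lra.
have lr : lim (W t @[t --> x^'-]) = lim (W t @[t --> x^'+]).
  by apply/eqP; apply/negPn/negP => lr; apply: ndx; split.
have e20 : 0 < e / 2 by rewrite divr_gt0.
have [p [/andP[ap px] Wp]] : exists p : rat, a < ratr p < x /\
    `|lim (W t @[t --> x^'-]) - W (ratr p)| < e / 2.
  have /cvgrPdist_lt/(_ _ e20)/= : W t @[t --> x^'-] --> lim (W t @[t --> x^'-]) by [].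
  rewrite near_withinE => -[d /= d0 Hd].
  have /rat_in_itvoo[p] : Num.max a (x - d) < x by rewrite gt_max ax ltrBlDr ltrDl.
  rewrite in_itv /= gt_max => /andP[/andP[ap xdp] px]; exists p; rewrite ap px; split => //.
  by apply: Hd => //=; rewrite gtr0_norm; lra.
have [q [/andP[xq qb] Wq]] : exists q : rat, x < ratr q < b /\
    `|lim (W t @[t --> x^'+]) - W (ratr q)| < e / 2.
  have /cvgrPdist_lt/(_ _ e20)/= : W t @[t --> x^'+] --> lim (W t @[t --> x^'+]) by [].
  rewrite near_withinE => -[d /= d0 Hd].
  have /rat_in_itvoo[q] : x < Num.min b (x + d) by rewrite lt_min xb ltrDl.
  rewrite in_itv /= lt_min => /andP[xq /andP[qb qd]]; exists q; rewrite xq qb; split => //.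
  by apply: Hd => //=; rewrite ltr0_norm; lra.
exists p, q; split; rewrite ?ap ?xq//.
rewrite (le_lt_trans (ler_norm _))// (le_lt_trans (ler_distD (lim (W t @[t --> x^'+])) _ _))//.
by rewrite distrC -[X in _ + `|X - _|]lr (splitr e) ltrD.
Unshelve. all: by end_near. Qed.

(** The index type lets several families of functions share one enumeration; codes that decode to
    nothing get the harmless default [(i0, 0)]. *)
Lemma rat_enum_exists {R : realType} (I : countType) (i0 : I) : exists q : nat -> I * R,
  forall i (r : rat), exists n, q n = (i, ratr r).
Proof.
exists (fun n => if unpickle n is Some (i, r) then (i, ratr (r : rat)) else (i0, 0)).
by move=> i r; exists (pickle (i, r)); rewrite pickleK.
Qed.

(** F and W are extracted together, so that V dominates the increments of G. At a continuity point x
    of V, rationals p < x < r with V r - V p small control the increments from p to x of G and of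
    every late F; the bad points are thus among the countably many jumps of V. *)
Lemma helly_selection {R : realType} (a b M : R) (F W : nat -> R -> R) :
  (forall n x y, a <= x -> x <= y -> y <= b -> `|F n y - F n x| <= W n y - W n x) ->
  (forall n x, a <= x <= b -> `|F n x| <= M /\ `|W n x| <= M) ->
  exists (k : nat -> nat) (G V : R -> R), [/\ {homo k : m n / (m < n)%N},
    forall x y, a <= x -> x <= y -> y <= b -> `|G y - G x| <= V y - V x,
    forall x, a <= x <= b -> `|G x| <= M &
    countable [set x | a < x < b /\ ~ (F (k m) x @[m --> \oo] --> G x)]].
Proof.
move=> FW FM.
(* The Boolean selects F or W; the value 0 outside [a, b] makes the bound valid for all
   arguments. *)
pose f n (t : bool * R) := if a <= t.2 <= b then (if t.1 then F n t.2 else W n t.2) else 0.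
have fM n t : `|f n t| <= `|M|.
  rewrite /f; case: ifPn => [/FM-/(_ n)[? ?]|_]; last by rewrite normr0.
  by case: ifP => _; apply: le_trans (ler_norm M).
have [q qP] := @rat_enum_exists R bool true.
have [g [k [hk gk gf]]] := pointwise_extraction f (fun=> `|M|) q fM.
pose G x := g (true, x); pose V x := g (false, x).
have GV x y : a <= x -> x <= y -> y <= b -> `|G y - G x| <= V y - V x.
  move=> ax xy yb; apply/ler_addgt0Pl => e e0.
  have e40 : 0 < e / 4 by rewrite divr_gt0.
  (* One index approximates all four values, so its inequality passes to G and V up to e. *)
  have [n nP] := gf [:: (true, x); (true, y); (false, x); (false, y)] _ e40.
  have axb : a <= x <= b by rewrite ax (le_trans xy).
  have ayb : a <= y <= b by rewrite yb (le_trans ax).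
  have := nP (true, x); have := nP (true, y); have := nP (false, x); have := nP (false, y).
  rewrite !inE !eqxx ?orbT /f /= axb ayb -/(G x) -/(G y) -/(V x) -/(V y).
  move=> /(_ isT) + /(_ isT) + /(_ isT) + /(_ isT).
  have := FW n _ _ ax xy yb.
  rewrite ler_norml !ltr_norml => /andP[? ?] /andP[? ?] /andP[? ?] /andP[? ?] /andP[? ?].
  by rewrite ler_norml; apply/andP; split; lra.
have kr i (r : rat) : a < ratr r < b -> f (k m) (i, ratr r) @[m --> \oo] --> g (i, ratr r).
  by move=> _; have [n <-] := qP i r; exact: gk.
have kF (r : rat) : a < ratr r < b -> F (k m) (ratr r) @[m --> \oo] --> G (ratr r).
  move=> /[dup] arb /(kr true); rewrite /f /=.
  by have /andP[/ltW-> /ltW->] := arb.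
have kW (r : rat) : a < ratr r < b -> W (k m) (ratr r) @[m --> \oo] --> V (ratr r).
  move=> /[dup] arb /(kr false); rewrite /f /=.
  by have /andP[/ltW-> /ltW->] := arb.
have ndV : {in `[a, b] &, {homo V : s t / s <= t}}.
  move=> s t; rewrite !in_itv /= => /andP[as_ _] /andP[_ tb] st.
  by rewrite -subr_ge0; apply: le_trans (GV _ _ as_ st tb).
exists k, G, V; split => //.
  move=> x axb; apply/ler_addgt0Pl => e e0.
  have [n nP] := gf [:: (true, x)] _ e0.
  have := nP (true, x); rewrite mem_head => /(_ isT); rewrite /f /= axb -/(G x).
  have [+ _] := FM n _ axb; move=> FxM; rewrite distrC => Fx.
  have := ler_normD (G x - F n x) (F n x); rewrite subrK; lra.
apply: sub_countable (discontinuity_countable ndV).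
apply: subset_card_le => x [axb]; apply: contra_notP.
rewrite /= in_itv /= axb => nd.
have {}nd : ~ discontinuity V x by move=> ?; apply: nd.
apply/cvgrPdist_lt => /= e e0.
(* Budget: one fifth for V x - V p, one for the values of F and G at p, and three for the increment
   of W from p to x, which is at most that from p to r, itself within 2 e/5 of V r - V p. *)
have e50 : 0 < e / 5 by rewrite divr_gt0.
have [p [r [/andP[ap px] /andP[xr rb] Vpr]]] := nondecreasing_bracket _ _ _ _ ndV axb nd _ e50.
have apb : a < ratr p < b by rewrite ap (lt_trans px)//; case/andP: axb.
have arb : a < ratr r < b by rewrite rb (lt_trans _ xr)//; case/andP: axb.
have GVp : `|G x - G (ratr p)| <= V x - V (ratr p).
  by apply: GV; rewrite ?ltW//; case/andP: axb.
have GVr : `|G (ratr r) - G x| <= V (ratr r) - V x.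
  by apply: GV; rewrite ?ltW//; case/andP: axb.
near=> m.
have H1 : `|G (ratr p) - F (k m) (ratr p)| < e / 5.
  by near: m; move/cvgrPdist_lt : (kF _ apb); apply.
have H2 : `|V (ratr p) - W (k m) (ratr p)| < e / 5.
  by near: m; move/cvgrPdist_lt : (kW _ apb); apply.
have H3 : `|V (ratr r) - W (k m) (ratr r)| < e / 5.
  by near: m; move/cvgrPdist_lt : (kW _ arb); apply.
have H4 : `|F (k m) x - F (k m) (ratr p)| <= W (k m) x - W (k m) (ratr p).
  by apply: FW; rewrite ?ltW//; case/andP: axb.
have H5 : `|F (k m) (ratr r) - F (k m) x| <= W (k m) (ratr r) - W (k m) x.
  by apply: FW; rewrite ?ltW//; case/andP: axb.
have H6 := normr_ge0 (F (k m) (ratr r) - F (k m) x).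
have H7 := normr_ge0 (G (ratr r) - G x).
clear -Vpr GVp GVr H1 H2 H3 H4 H5 H6 H7.
move: GVp H1 H2 H3 H4; rewrite !ler_norml !ltr_norml.
move=> /andP[? ?] /andP[? ?] /andP[? ?] /andP[? ?] /andP[? ?].
by apply/andP; split; lra.
Unshelve. all: by end_near. Qed.

(** The enumerated points comprise all uniform grids of [a, b], ends included; on a finite grid
    finer than the common modulus of continuity, pointwise convergence upgrades to uniform
    convergence on [a, b]. *)
Lemma equicontinuous_selection {R : realType} (a b M : R) (f : nat -> R -> R) :
  (forall n x, a <= x <= b -> `|f n x| <= M) ->
  (forall e, 0 < e -> exists2 d, 0 < d & forall n, {in `[a, b] &, forall x y,
    `|x - y| < d -> `|f n x - f n y| < e}) ->
  exists (k : nat -> nat) (g : R -> R), {homo k : m n / (m < n)%N} /\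
    forall e, 0 < e -> \forall m \near \oo, {in `[a, b], forall x, `|f (k m) x - g x| < e}.
Proof.
move=> fM fe.
pose h n x := if a <= x <= b then f n x else 0.
have hM n x : `|h n x| <= `|M|.
  rewrite /h; case: ifPn => [/fM-/(_ n)?|_]; last by rewrite normr0.
  exact: le_trans (ler_norm M).
pose grid N j : R := a + (b - a) * (j%:R / N.+1%:R).
have [g [k [hk gk gf]]] := pointwise_extraction h (fun=> `|M|)
  (fun n => if unpickle n is Some (N, j) then grid N j else a) hM.
have gc N j : h (k m) (grid N j) @[m --> \oo] --> g (grid N j).
  by have := gk (pickle (N, j)); rewrite pickleK.
exists k, g; split => // e e0.
have e50 : 0 < e / 5 by rewrite divr_gt0.
have [d d0 fd] := fe _ e50.
(* One fifth comes from f n and one from each of the two approximations. The final estimate adds e/5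
   for the oscillation of f and e/5 at the grid point. *)
have gd : {in `[a, b] &, forall x y, `|x - y| < d -> `|g x - g y| < 3 * (e / 5)}.
  move=> x y xab yab xy.
  have [n nP] := gf [:: x; y] _ e50.
  have := nP x; have := nP y; rewrite !inE !eqxx ?orbT => /(_ isT) + /(_ isT).
  rewrite /h; move: (xab) (yab); rewrite !in_itv /= => -> ->.
  have := fd n x y xab yab xy; rewrite !ltr_norml => /andP[? ?] /andP[? ?] /andP[? ?].
  by apply/andP; split; lra.
have [ab|ba] := leP a b; last first.
  near=> m => x; rewrite in_itv /= => /andP[? ?]; lra.
pose N := Num.truncn ((b - a) / d).
have N0 : 0 < N.+1%:R :> R by rewrite ltr0n.
have Nd : (b - a) / N.+1%:R < d.
  by rewrite ltr_pdivrMr// mulrC -ltr_pdivrMr// truncnS_gt.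
near=> m => x xab.
(* The index is the integer part of the rescaled position of x; x = b gives N + 1, whence N + 2
   indices. The degenerate case a = b would divide by zero and is treated apart. *)
have [j [xj jx]] : exists j : 'I_N.+2, grid N j <= x /\ x - grid N j < d.
  have [axE|ax] := eqVneq a b.
    exists ord0; rewrite /grid axE subrr mul0r addr0.
    by move: xab; rewrite in_itv /= axE => /le_anti <-; rewrite subrr.
  have ba0 : 0 < b - a by rewrite subr_gt0 lt_neqAle ax.
  have : x \in `[a, b] by []; rewrite in_itv /= => /andP[ax' xb].
  pose t := (x - a) * N.+1%:R / (b - a).
  have t0 : 0 <= t by rewrite divr_ge0 ?mulr_ge0 ?subr_ge0// ltW.
  have tN : t <= N.+1%:R by rewrite ler_pdivrMr// mulrC ler_wpM2l// lerD2r.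
  have jN : (Num.truncn t < N.+2)%N.
    by rewrite ltnS -(ler_nat R); apply: le_trans tN; rewrite truncn_le.
  have xE : x = a + (b - a) * (t / N.+1%:R).
    by rewrite /t; field; rewrite !gt_eqF.
  exists (Ordinal jN); split => //=.
    rewrite /grid [leRHS]xE lerD2l ler_wpM2l ?(ltW ba0)// ler_pM2r ?invr_gt0//.
    by rewrite truncn_le.
  have -> : x - grid N (Num.truncn t) = (b - a) / N.+1%:R * (t - (Num.truncn t)%:R).
    by rewrite [X in X - _]xE /grid; field; rewrite gt_eqF.
  apply: le_lt_trans Nd; rewrite ler_piMr ?divr_ge0 ?ltW//.
  by rewrite ltrBlDl natr1 truncnS_gt.
(* [m] is fixed before x, hence before j: the finitely many grid points must be handled together. *)
have hj : forall j : 'I_N.+2, `|h (k m) (grid N j) - g (grid N j)| < e / 5.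
  near: m; apply: filter_forall => i.
  by have /cvgrPdist_lt/(_ _ e50) := gc N i; apply: filterS => n; rewrite distrC.
have gab : grid N j \in `[a, b].
  rewrite in_itv /= lerDl mulr_ge0 ?subr_ge0 ?divr_ge0//=.
  by apply: le_trans xj _; move: xab; rewrite in_itv /= => /andP[].
have := hj j; rewrite /h; move: (gab); rewrite in_itv /= => ->.
have xgd : `|x - grid N j| < d by rewrite ger0_norm// subr_ge0.
have := fd (k m) _ _ xab gab xgd; have := gd _ _ xab gab xgd.
rewrite !ltr_norml => /andP[? ?] /andP[? ?] /andP[? ?].
by apply/andP; split; lra.
Unshelve. all: by end_near. Qed.

(** * Dominated increments give measurability and bounded variation *)

Section bounded_variation.
Context {R : realType}.
Local Notation mu := (@lebesgue_measure R).
Implicit Types (a b x y M B : R) (f g F V : R -> R).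

Lemma lebesgue_measure_oo_lty a b : (mu `]a, b[%classic < +oo)%E.
Proof. by rewrite lebesgue_measure_itv /=; case: ifP => // _; rewrite ltry. Qed.

Lemma integrable_oo_bounded a b M f : measurable_fun `]a, b[ f ->
  {in `]a, b[, forall x, `|f x| <= M} -> mu.-integrable `]a, b[ (EFin \o f).
Proof.
move=> mf fM; apply: measurable_bounded_integrable => //.
  exact: lebesgue_measure_oo_lty.
exists M; split; first exact: num_real.
by move=> N MN x xab /=; apply: le_trans (ltW MN); exact: fM.
Qed.

Lemma fine_lebesgue_measure_oo a b : a <= b -> fine (mu `]a, b[%classic) = b - a.
Proof.
rewrite le_eqVlt lebesgue_measure_itv /= lte_fin => /predU1P[->|->//].
by rewrite ltxx subrr.
Qed.

Lemma Rintegral_oo_bound a b B f : a <= b -> measurable_fun `]a, b[ f ->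
  {in `]a, b[, forall x, `|f x| <= B} ->
  `|\int[mu]_(x in `]a, b[) f x| <= B * (b - a).
Proof.
move=> ab mf fB.
have fi : mu.-integrable `]a, b[ (EFin \o f) by exact: integrable_oo_bounded fB.
apply: le_trans; first exact: le_normr_Rintegral.
rewrite -fine_lebesgue_measure_oo// -Rintegral_cst//.
apply: le_Rintegral => //; first exact: integrable_norm.
apply: integrable_oo_bounded (`|B|) _ _ _ => // x _; exact: lexx.
Qed.

Lemma Rintegral_ooB a x y f : a <= x -> x < y ->
  mu.-integrable `]a, y[ (EFin \o f) ->
  \int[mu]_(t in `]a, y[) f t - \int[mu]_(t in `]a, x[) f t = \int[mu]_(t in `]x, y[) f t.
Proof.
move=> ax xy fi.
have fiax : mu.-integrable `]a, x[ (EFin \o f).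
  by apply: integrableS fi => //; apply: subset_itvl; rewrite bnd_simp ltW.
move: ax; rewrite le_eqVlt => /predU1P[<-|ax].
  by rewrite set_itvoo0 // Rintegral_set0 subr0.
rewrite (Rintegral_itv_bndo_bndc fiax).
by rewrite Rintegral_itvB// bnd_simp ltW.
Qed.

(** F + V and V - F are nondecreasing and F is half of their difference; preimages of half-lines
    under a nondecreasing function are intervals. *)
Lemma increment_dominated_measurable a b F V :
  (forall x y, a <= x -> x <= y -> y <= b -> `|F y - F x| <= V y - V x) ->
  measurable_fun `]a, b[ F.
Proof.
move=> FV.
have mm f : {in `[a, b] &, {homo f : s t / s <= t}} -> measurable_fun `]a, b[ f.
  move=> ndf; apply: (measurability (@RGenCInfty.G R)) => [|/= _ [_ [r ->] <-]].
    exact: RGenCInfty.measurableE.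
  apply: is_interval_measurable => s t /=.
  rewrite !in_itv /= !andbT => -[/andP[? ?] fs] [/andP[? ?] ft] u /andP[su ut].
  rewrite !in_itv /= !andbT; split; first by apply/andP; split; lra.
  by apply: le_trans fs _; apply: ndf => //; rewrite in_itv /=; apply/andP; split; lra.
have -> : F = (fun x => 2^-1 * ((F x + V x) - (V x - F x))).
  by apply/funext => x; field.
apply: measurable_funM => //; apply: measurable_funB; apply: mm => s t;
  rewrite !in_itv /= => /andP[as_ _] /andP[_ tb] st;
  have := FV _ _ as_ st tb; rewrite ler_norml => /andP[? ?]; lra.
Qed.

(** Integration by parts without Stieltjes integrals: [P] vanishes at a, equals the tested integral
    at b, and its short increments are at most twice those of V. The factor 2 is harmless, as
    [BV_space] asks only for some finite bound. *)
Lemma dominated_increment_BV a b M F V : a < b ->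
  (forall x y, a <= x -> x <= y -> y <= b -> `|F y - F x| <= V y - V x) ->
  {in `[a, b], forall x, `|F x| <= M} -> BV_space a b F.
Proof.
move=> ab FV FM.
have mF := increment_dominated_measurable _ _ _ _ FV.
have iF : mu.-integrable `]a, b[ (EFin \o F).
  by apply: (integrable_oo_bounded _ _ M) => // x /subset_itv_oo_cc /FM.
split.
  apply/Lfun1_integrable; rewrite -restrict_EFin.
  exact: (@integrable_mkcond _ _ R mu _ (EFin \o F) (measurable_itv `]a, b[)).1 iF.
exists (2 * (V b - V a)) => phi [dphi cphi cpt supp] phi1.
have phi0 x : ~~ (a < x < b) -> phi x = 0.
  apply: contraNeq => px0; have := supp x; rewrite /= in_itv /=; apply.
  exact: subset_closure.
have [K K0 phiK] : exists2 K, 0 < K & {in `[a, b], forall x, `|derive1 phi x| <= K}.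
  have [|c cab cmax] := @EVT_max R (fun x => `|derive1 phi x|) a b (ltW ab).
    by apply: continuous_subspaceT => x; apply: cvg_norm; exact: cphi.
  exists (`|derive1 phi c| + 1); first by rewrite ltr_wpDl.
  by move=> x /cmax xc; rewrite (le_trans xc)// lerDl.
have mphi' : measurable_fun `]a, b[ (derive1 phi).
  by apply: measurable_funTS; exact: continuous_measurable_fun.
have mFphi : measurable_fun `]a, b[ (fun t => F t * derive1 phi t) by exact: measurable_funM.
have iFphi : mu.-integrable `]a, b[ (EFin \o (fun t => F t * derive1 phi t)).
  apply: (integrable_oo_bounded _ _ (M * K)) => // x /subset_itv_oo_cc xab.
  by rewrite normrM ler_pM// ?FM ?phiK.
(* Formally, minus the integral of phi dF from a to y. *)
pose P y := \int[mu]_(t in `]a, y[) (F t * derive1 phi t) - F y * phi y.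
have Pa : P a = 0.
  by rewrite /P set_itvoo0 // Rintegral_set0 phi0 ?ltxx// mulr0 subr0.
have Pb : P b = \int[mu]_(t in `]a, b[) (F t * derive1 phi t).
  by rewrite /P phi0 ?ltxx ?andbF// mulr0 subr0.
rewrite -Pb; apply: le_trans (ler_norm _) _; rewrite -[P b]subr0 -Pa mulrBr.
have d0 : 0 < K^-1 by rewrite invr_gt0.
apply: (increment_chain a b _ P (fun x => 2 * V x) d0) => //; last exact: ltW.
move=> x y ax xy yb yx.
have sub : `]x, y[%classic `<=` `]a, b[%classic by apply: subset_itv; rewrite bnd_simp.
have iay : mu.-integrable `]a, y[ (EFin \o (fun t => F t * derive1 phi t)).
  by apply: integrableS iFphi => //; apply: subset_itvl; rewrite bnd_simp.
have iphi' : mu.-integrable `]x, y[ (EFin \o derive1 phi).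
  by apply: integrable_oo_continuous; exact: continuous_subspaceT.
have FTC : \int[mu]_(t in `]x, y[) derive1 phi t = phi y - phi x.
  exact: (Rintegral_derive1 _ _ _ xy dphi cphi).
have mc : measurable_fun `]x, y[ (fun t => (F t - F x) * derive1 phi t).
  apply: measurable_funM; last exact: measurable_funS mphi'.
  by apply: measurable_funB => //; exact: measurable_funS mF.
(* Subtracting the constant F x makes the integral of second order, at most (V y - V x) K (y - x),
   which y - x < 1/K absorbs into V y - V x. *)
have E : P y - P x = \int[mu]_(t in `]x, y[) ((F t - F x) * derive1 phi t)
    - (F y - F x) * phi y.
  have -> : \int[mu]_(t in `]x, y[) ((F t - F x) * derive1 phi t) =
      \int[mu]_(t in `]x, y[) (F t * derive1 phi t) - F x * (phi y - phi x).
    rewrite -FTC -RintegralZl// -RintegralB//.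
    - by apply: eq_Rintegral => t _; rewrite mulrBl.
    - exact: integrableS iFphi.
    - by have := @integrableZl _ _ R mu `]x, y[%classic _ (F x) _ iphi'; apply.
  by rewrite -(Rintegral_ooB a)// /P; ring.
have B1 : `|\int[mu]_(t in `]x, y[) ((F t - F x) * derive1 phi t)| <= ((V y - V x) * K) * (y - x).
  apply: Rintegral_oo_bound => //; first exact: ltW.
  move=> t; rewrite in_itv /= => /andP[xt ty].
  rewrite normrM ler_pM//; last by apply: phiK; rewrite in_itv /=; apply/andP; split; lra.
  have h1 : `|F t - F x| <= V t - V x by apply: FV; lra.
  have h2 : `|F y - F t| <= V y - V t by apply: FV; lra.
  by have := normr_ge0 (F y - F t); lra.
have h : `|F y - F x| <= V y - V x by apply: FV => //; exact: ltW.
have V0 : 0 <= V y - V x by apply: le_trans h.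
have B2 : `|(F y - F x) * phi y| <= V y - V x.
  by rewrite normrM (le_trans _ h)// ler_piMr.
have B3 : (V y - V x) * K * (y - x) <= V y - V x.
  rewrite -mulrA ler_piMr// mulrC -ler_pdivlMr// mul1r; exact: ltW.
rewrite E (le_trans (ler_normB _ _))//; lra.
Qed.

End bounded_variation.

(** * Hölder norms below the exponent 1/2 *)

Section holder.
Context {R : realType}.
Implicit Types (a b gamma A B K r s eta : R) (f : R -> R).

Lemma holder_norm_ge0_le a b gamma A B f : a < b ->
  {in `[a, b], forall x, `|f x| <= A} ->
  {in `[a, b] &, forall x y, x != y -> `|f x - f y| <= B * `|x - y| `^ gamma} ->
  (0 <= holder_norm `[a, b] gamma f <= (A + B)%:E)%E.
Proof.
move=> ab fA fB.
have aab : `[a, b]%classic a by rewrite /= in_itv /= lexx ltW.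
have bab : `[a, b]%classic b by rewrite /= in_itv /= lexx ltW.
rewrite /holder_norm EFinD; apply/andP; split.
  apply: adde_ge0.
    apply: le_trans (ereal_sup_ubound _); last by exists a.
    by rewrite lee_fin.
  apply: le_trans (ereal_sup_ubound _); last by exists (a, b) => //; split => //; rewrite lt_eqF.
  by rewrite lee_fin divr_ge0// powR_ge0.
apply: leeD.
  by apply: ge_ereal_sup => _ [x xab <-]; rewrite lee_fin; exact: fA.
apply: ge_ereal_sup => _ [[x y] [xab yab xy] <-] /=; rewrite lee_fin.
rewrite ler_pdivrMr; first exact: fB.
by rewrite powR_gt0// normr_gt0 subr_eq0.
Qed.

(** Split r^(1/2) as r^(1/2 - gamma) r^gamma; the first factor is monotone in r. *)
Lemma sqrt_powR_le gamma r s : gamma <= 2^-1 -> 0 < r -> r <= s ->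
  Num.sqrt r <= s `^ (2^-1 - gamma) * r `^ gamma.
Proof.
move=> g r0 rs; rewrite -powR12_sqrt ?(ltW r0)//.
rewrite -{1}(subrK gamma 2^-1) powRD; last by rewrite (gt_eqF r0) implybT.
by rewrite ler_wpM2r ?powR_ge0// ge0_ler_powR ?nnegrE ?subr_ge0// ltW// (lt_le_trans r0).
Qed.

Lemma holder_norm_fin_num a b gamma A K f : a < b -> gamma <= 2^-1 -> 0 <= K ->
  {in `[a, b], forall x, `|f x| <= A} ->
  {in `[a, b] &, forall x y, `|f x - f y| <= K * Num.sqrt `|x - y|} ->
  holder_norm `[a, b] gamma f \is a fin_num.
Proof.
move=> ab g K0 fA fK.
have /(holder_norm_ge0_le _ _ gamma A (K * (b - a) `^ (2^-1 - gamma)) f ab fA) : 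
    {in `[a, b] &, forall x y, x != y ->
      `|f x - f y| <= K * (b - a) `^ (2^-1 - gamma) * `|x - y| `^ gamma}.
  move=> x y xab yab xy; apply: le_trans (fK _ _ xab yab) _.
  rewrite -mulrA ler_wpM2l// sqrt_powR_le// ?normr_gt0 ?subr_eq0//.
  move: xab yab; rewrite !in_itv /= => /andP[? ?] /andP[? ?].
  by rewrite ler_norml; apply/andP; split; lra.
move=> /andP[h0 hy]; rewrite ge0_fin_numE//.
by apply: le_lt_trans hy _; rewrite ltry.
Qed.

(* At small distances the Hölder-1/2 bound controls the quotient, at large ones the sup norm. *)
Lemma holder_norm_small a b gamma K eta : a < b -> 0 < gamma < 2^-1 -> 0 < K -> 0 < eta ->
  exists2 s, 0 < s & forall f, {in `[a, b], forall x, `|f x| <= s} ->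
    {in `[a, b] &, forall x y, `|f x - f y| <= K * Num.sqrt `|x - y|} ->
    (0 <= holder_norm `[a, b] gamma f <= eta%:E)%E.
Proof.
move=> ab /andP[g0 g2] K0 eta0.
pose eta2 := eta / 2.
have eta20 : 0 < eta2 by rewrite divr_gt0.
have h0 : 0 < 2^-1 - gamma by rewrite subr_gt0.
(* The radius at which K r^(1/2 - gamma) reaches eta / 2. Beyond it the quotient is at most 2 s /
   r0^gamma, which dictates the second term in the choice of s. *)
pose r0 := (eta2 / K) `^ (2^-1 - gamma)^-1.
have r00 : 0 < r0 by rewrite powR_gt0// divr_gt0.
have r0E : r0 `^ (2^-1 - gamma) = eta2 / K.
  by rewrite -powRrM mulVf ?gt_eqF// powRr1// ltW// divr_gt0.
have r0g : 0 < r0 `^ gamma by rewrite powR_gt0.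
exists (Num.min eta2 (eta2 * r0 `^ gamma / 2)).
  by rewrite lt_min eta20 divr_gt0// mulr_gt0.
move=> f fs fK.
have -> : eta = eta2 + eta2 by rewrite -splitr.
apply: holder_norm_ge0_le => //.
  by move=> x /fs; rewrite le_min => /andP[].
move=> x y xab yab xy.
have xy0 : 0 < `|x - y| by rewrite normr_gt0 subr_eq0.
have [xyr|rxy] := leP `|x - y| r0.
  apply: le_trans (fK _ _ xab yab) _.
  have := sqrt_powR_le _ _ _ (ltW g2) xy0 xyr; rewrite r0E -mulrA.
  rewrite -(ler_pM2l K0) mulrA => /le_trans; apply.
  by rewrite mulrCA mulrA mulfVK ?gt_eqF// mulrC.
have := fs _ xab; have := fs _ yab; rewrite !le_min => /andP[_ fy] /andP[_ fx].
apply: le_trans (ler_normB _ _) _.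
apply: (@le_trans _ _ (eta2 * r0 `^ gamma)); first lra.
by rewrite ler_wpM2l ?(ltW eta20)// ge0_ler_powR ?nnegrE// ?ltW.
Qed.

End holder.

(** * The energy density *)

Section energy_bounds.
Context {R : realType}.
Local Notation mu := (@lebesgue_measure R).
Implicit Types (a b H L C E M eps x y t p q : R) (f g : R -> R) (u : R -> R * R).

Lemma wderivP a b f : H1 a b f -> weak_derivative a b f (wderiv a b f).
Proof. by move=> [_ [g fg _]]; rewrite /wderiv; apply: (@xgetPex _ _ (weak_derivative a b f)); exists g. Qed.

Definition defect u y : R := (u y).1 ^+ 2 + (u y).2 ^+ 2 - 1.

(** The integrand of [energy] with the square roots of [enorm] resolved. The factor 1/2 stays
    outside, hence the bound 2 * C on its integral. *)
Definition energy_density H L eps u y : R :=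
  eps * ((wderiv2 H u y).1 ^+ 2 + (wderiv2 H u y).2 ^+ 2)
  + eps^-1 * defect u y ^+ 2 + L * (wderiv2 H u y).2 ^+ 2.

(** All terms are nonnegative, so parts are bounded by the whole. The second bound makes the defect
    small, the third feeds Young's inequality for u1', the fourth gives the Hölder estimate for
    u2. *)
Lemma energy_density_ge H L eps u y : 0 < eps -> 0 < L ->
  [/\ 0 <= energy_density H L eps u y,
      defect u y ^+ 2 <= eps * energy_density H L eps u y,
      eps * (wderiv2 H u y).1 ^+ 2 + eps^-1 * defect u y ^+ 2 <= energy_density H L eps u y &
      L * (wderiv2 H u y).2 ^+ 2 <= energy_density H L eps u y].
Proof.
move=> e0 L0; rewrite /energy_density.
set g1 := (wderiv2 H u y).1; set g2 := (wderiv2 H u y).2.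
have h1 : 0 <= eps * g1 ^+ 2 by rewrite mulr_ge0 ?sqr_ge0// ltW.
have h2 : 0 <= eps * g2 ^+ 2 by rewrite mulr_ge0 ?sqr_ge0// ltW.
have h3 : 0 <= eps^-1 * defect u y ^+ 2 by rewrite mulr_ge0 ?sqr_ge0// invr_ge0 ltW.
have h4 : 0 <= L * g2 ^+ 2 by rewrite mulr_ge0 ?sqr_ge0// ltW.
split; try lra.
rewrite -ler_pdivrMl//; lra.
Qed.

Lemma measurable_within_continuous a b f : {within `[a, b], continuous f} ->
  measurable_fun `]a, b[ f.
Proof.
move=> cf; apply: (@measurable_funS _ _ _ _ `[a, b]%classic) => //.
  exact: subset_itv_oo_cc.
exact: subspace_continuous_measurable_fun.
Qed.

Lemma measurable_energy_density H L eps a u : admissible H a u ->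
  measurable_fun `]- H, H[ (energy_density H L eps u).
Proof.
move=> [[u1 u2 c1 c2] _].
have [_ [m1 _ _] _] := wderivP _ _ _ u1; have [_ [m2 _ _] _] := wderivP _ _ _ u2.
have {}c1 := measurable_within_continuous _ _ _ c1.
have {}c2 := measurable_within_continuous _ _ _ c2.
have mX f : measurable_fun `]- H, H[ f -> measurable_fun `]- H, H[ (fun x => f x ^+ 2).
  by move=> mf; exact: measurable_funX.
have mc : measurable_fun `]- H, H[ (defect u).
  by apply: measurable_funB => //; apply: measurable_funD; exact: mX.
apply: measurable_funD; first apply: measurable_funD.
- by apply: measurable_funM => //; apply: measurable_funD; exact: mX.
- by apply: measurable_funM => //; exact: mX.
- by apply: measurable_funM => //; exact: mX.
Qed.

Lemma energy_density_integrable H L eps a C u : 0 < eps -> 0 < L ->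
  admissible H a u -> (energy H L eps u <= C%:E)%E ->
  mu.-integrable `]- H, H[ (EFin \o energy_density H L eps u) /\
  \int[mu]_(y in `]- H, H[) energy_density H L eps u y <= 2 * C.
Proof.
move=> e0 L0 adm.
have me := measurable_energy_density _ L eps _ _ adm.
have d0 y : (0 <= (energy_density H L eps u y)%:E)%E.
  by have [+ _ _ _] := energy_density_ge H L eps u y e0 L0; rewrite lee_fin.
have -> : energy H L eps u =
    ((2^-1)%:E * \int[mu]_(y in `](- H)%R, H[) (energy_density H L eps u y)%:E)%E.
  congr (_ * _)%E; apply: eq_integral => y _; congr EFin.
  by rewrite /energy_density /enorm !sqr_sqrtr// addr_ge0// sqr_ge0.
have i0 : (0 <= \int[mu]_(y in `](- H)%R, H[) (energy_density H L eps u y)%:E)%E.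
  exact: integral_ge0.
rewrite -lee_pdivlMl// invrK -EFinM => iC.
split; last first.
  rewrite -lee_fin /Rintegral fineK ?ge0_fin_numE//.
  by apply: le_lt_trans iC _; rewrite ltry.
have lty : (\int[mu]_(y in `](- H)%R, H[) `|(energy_density H L eps u y)%:E| < +oo)%E.
  have -> : (\int[mu]_(y in `](- H)%R, H[) `|(energy_density H L eps u y)%:E| =
      \int[mu]_(y in `](- H)%R, H[) (energy_density H L eps u y)%:E)%E.
    by apply: eq_integral => y _; rewrite gee0_abs.
  by apply: le_lt_trans iC _; rewrite ltry.
by apply/integrableP; split; [exact/measurable_EFinP|exact: lty].
Qed.

End energy_bounds.

(** * Increments of the two components of one map *)

Section component_bounds.
Context {R : realType}.
Local Notation mu := (@lebesgue_measure R).
Implicit Types (a b A B H L C E M eps x y t p q : R) (f g e : R -> R) (u : R -> R * R).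

Lemma integrable_oo_subset a b x y f : a <= x -> y <= b ->
  mu.-integrable `]a, b[ (EFin \o f) -> mu.-integrable `]x, y[ (EFin \o f).
Proof.
by move=> ax yb; apply: integrableS => //; apply: subset_itv; rewrite bnd_simp.
Qed.

Lemma integrable_affine a b A B e : mu.-integrable `]a, b[ (EFin \o e) ->
  mu.-integrable `]a, b[ (EFin \o (fun t => A * e t + B)).
Proof.
move=> ie.
have iB : mu.-integrable `]a, b[ (EFin \o (fun=> B)).
  by apply: (integrable_oo_bounded _ _ `|B|) => // x _.
have iA := @integrableZl _ _ R mu `]a, b[%classic (measurable_itv _) A _ ie.
exact: (@integrableD _ _ R mu `]a, b[%classic (measurable_itv _) _ _ iA iB).
Qed.

Lemma Rintegral_affine a b A B e : a <= b -> mu.-integrable `]a, b[ (EFin \o e) ->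
  \int[mu]_(t in `]a, b[) (A * e t + B) = A * \int[mu]_(t in `]a, b[) e t + B * (b - a).
Proof.
move=> ab ie.
have iB : mu.-integrable `]a, b[ (EFin \o (fun=> B)).
  by apply: (integrable_oo_bounded _ _ `|B|) => // x _.
have iA := @integrableZl _ _ R mu `]a, b[%classic (measurable_itv _) A _ ie.
rewrite RintegralD; [|exact: measurable_itv|exact: iA|exact: iB].
by rewrite RintegralZl// Rintegral_cst// fine_lebesgue_measure_oo.
Qed.

Lemma integrable_le_affine a b A B f e : measurable_fun `]a, b[ f ->
  {in `]a, b[, forall t, `|f t| <= A * e t + B} ->
  mu.-integrable `]a, b[ (EFin \o e) -> mu.-integrable `]a, b[ (EFin \o f).
Proof.
move=> mf fe ie; apply: le_integrable (integrable_affine _ _ A B _ ie) => //.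
  exact/measurable_EFinP.
by move=> t tab /=; rewrite lee_fin (le_trans (fe _ tab))// ler_norm.
Qed.

Lemma le_Rintegral_affine a b A B f e : a <= b -> measurable_fun `]a, b[ f ->
  {in `]a, b[, forall t, `|f t| <= A * e t + B} ->
  mu.-integrable `]a, b[ (EFin \o e) ->
  \int[mu]_(t in `]a, b[) `|f t| <= A * \int[mu]_(t in `]a, b[) e t + B * (b - a).
Proof.
move=> ab mf fe ie; rewrite -Rintegral_affine//; apply: le_Rintegral => //.
- by apply: integrable_norm; exact: integrable_le_affine fe ie.
- exact: integrable_affine.
Qed.

Lemma le_Rintegral_oo_subset a b x y f : a <= x -> y <= b ->
  (forall t, 0 <= f t) -> mu.-integrable `]a, b[ (EFin \o f) ->
  \int[mu]_(t in `]x, y[) f t <= \int[mu]_(t in `]a, b[) f t.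
Proof.
move=> ax yb f0 fi; rewrite (Rintegral_oo_subset _ _ _ _ _ ax yb fi).
apply: le_Rintegral => //.
  rewrite -restrict_EFin; apply/integrable_restrict => //.
  by apply: integrableS fi => //; exact: measurableI.
by move=> t _; rewrite patchE; case: ifPn.
Qed.

Section one_map.
Variables (H L C a eps : R) (u : R -> R * R).
Hypotheses (L_gt0 : 0 < L) (eps_gt0 : 0 < eps).
Hypotheses (adm : admissible H a u) (en : (energy H L eps u <= C%:E)%E).

Local Notation e := (energy_density H L eps u).
Local Notation g1 := (wderiv (- H) H (fst \o u)).
Local Notation g2 := (wderiv (- H) H (snd \o u)).

Lemma measurable_wderivs :
  measurable_fun `]- H, H[ g1 /\ measurable_fun `]- H, H[ g2.
Proof.
have [[u1 u2 _ _] _] := adm.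
by have [_ [m1 _ _] _] := wderivP _ _ _ u1; have [_ [m2 _ _] _] := wderivP _ _ _ u2.
Qed.

(** [wderiv] is a choice, for which the weak formulation supplies only local integrability.
    Integrability up to the ends is read off the energy, from g^2 <= e / eps or g^2 <= e / L
    together with 2 |g| <= g^2 + 1. *)
Lemma wderivs_integrable :
  mu.-integrable `]- H, H[ (EFin \o g1) /\ mu.-integrable `]- H, H[ (EFin \o g2).
Proof.
have [ie _] := energy_density_integrable _ _ _ _ _ _ eps_gt0 L_gt0 adm en.
have [m1 m2] := measurable_wderivs.
split.
  apply: (integrable_le_affine _ _ eps^-1 1) ie => // t _.
  have [_ _ + _] := energy_density_ge H L eps u t eps_gt0 L_gt0.
  move=> h; have h1 : g1 t ^+ 2 <= eps^-1 * e t.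
    rewrite -ler_pdivrMl ?invr_gt0// invrK; apply: le_trans h.
    by rewrite lerDl mulr_ge0 ?sqr_ge0// invr_ge0 ltW.
  have := sqr_ge0 (`|g1 t| - 1); rewrite sqrrB1 real_normK ?num_real//.
  have := normr_ge0 (g1 t); lra.
apply: (integrable_le_affine _ _ L^-1 1) ie => // t _.
have [_ _ _ +] := energy_density_ge H L eps u t eps_gt0 L_gt0.
move=> h; have h1 : g2 t ^+ 2 <= L^-1 * e t.
  by rewrite -ler_pdivrMl ?invr_gt0// invrK; apply: le_trans h.
have := sqr_ge0 (`|g2 t| - 1); rewrite sqrrB1 real_normK ?num_real//.
have := normr_ge0 (g2 t); lra.
Qed.

Lemma component_increments x y : - H <= x -> x < y -> y <= H ->
  `|(u y).1 - (u x).1| <= \int[mu]_(t in `]x, y[) `|g1 t| /\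
  `|(u y).2 - (u x).2| <= \int[mu]_(t in `]x, y[) `|g2 t|.
Proof.
move=> Hx xy yH; have [[u1 u2 c1 c2] _] := adm; have [i1 i2] := wderivs_integrable.
split.
- exact: (weak_derivative_increment _ _ _ _ _ _ c1 (wderivP _ _ _ u1) i1).
- exact: (weak_derivative_increment _ _ _ _ _ _ c2 (wderivP _ _ _ u2) i2).
Qed.

(** Young's inequality with weight s = sqrt (y - x) replaces Cauchy-Schwarz: |g2| <= s g2^2 / 2 + 1
    / (2 s). Integration gives s C / L from the energy and s / 2 from the length. *)
Lemma second_component_holder : {in `[- H, H] &, forall x y,
  `|(u x).2 - (u y).2| <= (C / L + 2^-1) * Num.sqrt `|x - y|}.
Proof.
suff lt_case x y : - H <= x -> x < y -> y <= H ->
    `|(u y).2 - (u x).2| <= (C / L + 2^-1) * Num.sqrt (y - x).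
  move=> x y; rewrite !in_itv /= => /andP[Hx xH] /andP[Hy yH].
  have [xy|yx|->] := ltgtP x y.
  - by rewrite distrC [X in Num.sqrt X]distrC (gtr0_norm (x := y - x)) ?subr_gt0// lt_case.
  - by rewrite (gtr0_norm (x := x - y)) ?subr_gt0// lt_case.
  - by rewrite !subrr !normr0 sqrtr0 mulr0.
move=> Hx xy yH; have [_] := component_increments x y Hx xy yH.
have [ie iC] := energy_density_integrable _ _ _ _ _ _ eps_gt0 L_gt0 adm en.
have [_ m2] := measurable_wderivs.
set s := Num.sqrt (y - x).
have s0 : 0 < s by rewrite sqrtr_gt0 subr_gt0.
have ss : s ^+ 2 = y - x by rewrite sqr_sqrtr// subr_ge0 ltW.
have iexy := integrable_oo_subset _ _ _ _ _ Hx yH ie.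
have e0 t : 0 <= e t by have [] := energy_density_ge H L eps u t eps_gt0 L_gt0.
have : \int[mu]_(t in `]x, y[) `|g2 t| <=
    (s / (2 * L)) * \int[mu]_(t in `]x, y[) e t + (2 * s)^-1 * (y - x).
  apply: le_Rintegral_affine => //; first exact: ltW.
    apply: measurable_funS m2 => //; apply: subset_itv; by rewrite bnd_simp.
  move=> t _; have [_ _ _ h] := energy_density_ge H L eps u t eps_gt0 L_gt0.
  have h1 : g2 t ^+ 2 <= L^-1 * e t.
    by rewrite -ler_pdivrMl ?invr_gt0// invrK; apply: le_trans h.
  apply: (@le_trans _ _ (s / 2 * g2 t ^+ 2 + (2 * s)^-1)); last first.
    rewrite lerD2r (_ : s / (2 * L) * e t = s / 2 * (L^-1 * e t)); last first.
      by field; rewrite gt_eqF.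
    by rewrite ler_wpM2l// divr_ge0// ltW.
  have -> : s / 2 * g2 t ^+ 2 + (2 * s)^-1 = `|g2 t| + (s * `|g2 t| - 1) ^+ 2 / (2 * s).
    by rewrite -(real_normK (num_real (g2 t))); field; rewrite gt_eqF.
  by rewrite lerDl divr_ge0 ?sqr_ge0// mulr_ge0// ltW.
move=> h1 h2; apply: le_trans h2 _; apply: le_trans h1 _.
have h3 : \int[mu]_(t in `]x, y[) e t <= 2 * C.
  by apply: le_trans iC; exact: le_Rintegral_oo_subset.
apply: (@le_trans _ _ (s / (2 * L) * (2 * C) + (2 * s)^-1 * (y - x))).
  by rewrite lerD2r ler_wpM2l// divr_ge0 ?mulr_ge0// ltW.
by rewrite -ss le_eqVlt; apply/orP; left; apply/eqP; field; rewrite !gt_eqF.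
Qed.

End one_map.

End component_bounds.

(** * The potential, its finite differences and pointwise estimates *)

Section potential.
Context {R : realType}.
Local Notation mu := (@lebesgue_measure R).
Implicit Types (a H L C E M eps x y t p q r s d : R) (u : R -> R * R).

(* A primitive in p of p^2 + q^2 - 1. *)
Definition potential p q : R := p ^+ 3 / 3 - p * (1 - q ^+ 2).

(** The divided difference of [potential] in its first variable, at second variable q'; for p' = p
    it is p^2 + q'^2 - 1. *)
Definition slope1 (p p' q' : R) : R := (p' ^+ 2 + p' * p + p ^+ 2) / 3 - 1 + q' ^+ 2.

(** Follow the corner (p, q), (p, q'), (p', q'). This identity stands in for the chain rule. *)
Lemma potential_increment (p q p' q' : R) :
  potential p' q' - potential p q =
  slope1 p p' q' * (p' - p) + p * (q + q') * (q' - q).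
Proof. by rewrite /potential /slope1; field. Qed.

(** Every difference of quadratic terms factors through a displacement of size d: six contributions
    M1 d, divided by 3, give 2 M1 d, and q'^2 - s^2 gives 2 M d. *)
Lemma slope1_defect (p p' q' r s M1 M d : R) :
  `|p| <= M1 -> `|p'| <= M1 -> `|r| <= M1 -> `|q'| <= M -> `|s| <= M ->
  `|p - r| <= d -> `|p' - r| <= d -> `|q' - s| <= d ->
  `|slope1 p p' q' - (r ^+ 2 + s ^+ 2 - 1)| <= 2 * (M1 + M) * d.
Proof.
move=> pM p'M rM qM sM pr p'r qs.
have -> : slope1 p p' q' - (r ^+ 2 + s ^+ 2 - 1) =
    ((p' + r) * (p' - r) + (p' * (p - r) + r * (p' - r)) + (p + r) * (p - r)) / 3
    + (q' + s) * (q' - s) by rewrite /slope1; field.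
have D (v w N : R) : `|v| <= N -> `|w| <= d -> `|v * w| <= N * d.
  by move=> vN wd; rewrite normrM ler_pM.
have S (v w N : R) : `|v| <= N -> `|w| <= N -> `|v + w| <= 2 * N.
  by move=> vN wN; apply: le_trans (ler_normD _ _) _; lra.
have h1 := D _ _ _ (S _ _ _ p'M rM) p'r.
have h2 := D _ _ _ p'M pr; have h3 := D _ _ _ rM p'r.
have h4 := D _ _ _ (S _ _ _ pM rM) pr; have h5 := D _ _ _ (S _ _ _ qM sM) qs.
move: h1 h2 h3 h4 h5; rewrite !ler_norml => /andP[? ?] /andP[? ?] /andP[? ?] /andP[? ?] /andP[? ?].
by apply/andP; split; lra.
Qed.

(** Here c1 and c2 are the slopes in the two variables, v1 and v2 the derivatives. Young's
    inequality pairs Q and eps with v1, and |r| + 1 with v2; r has no bound of its own and is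
    controlled through r^2 = Q + 1 - s^2. *)
Lemma slopes_weighted_le E L M eps (ee c1 c2 v1 v2 : R) r s :
  0 < eps -> eps <= E -> 0 < L -> 0 <= M -> 0 <= ee ->
  `|c1| <= `|r ^+ 2 + s ^+ 2 - 1| + eps -> `|c2| <= 2 * M * (`|r| + 1) ->
  eps * v1 ^+ 2 + eps^-1 * (r ^+ 2 + s ^+ 2 - 1) ^+ 2 <= ee ->
  L * v2 ^+ 2 <= ee -> (r ^+ 2 + s ^+ 2 - 1) ^+ 2 <= eps * ee ->
  `|c1| * `|v1| + `|c2| * `|v2| <= (1 + M * (E + L^-1)) * ee + (E / 2 + 5 * M).
Proof.
move=> e0 eE L0 M0 ee0; set Q := r ^+ 2 + s ^+ 2 - 1 => c1Q c2M h1 h2 h3.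
have sq (v : R) : v ^+ 2 = `|v| ^+ 2 by rewrite real_normK// num_real.
have H1 : `|c1| * `|v1| <= (`|Q| + eps) * `|v1| by rewrite ler_wpM2r.
have H2 : `|c2| * `|v2| <= 2 * M * (`|r| + 1) * `|v2| by rewrite ler_wpM2r.
have H3 : 2 * (`|Q| * `|v1|) <= eps * v1 ^+ 2 + eps^-1 * Q ^+ 2.
  rewrite (sq v1) (sq Q) -subr_ge0.
  have -> : eps * `|v1| ^+ 2 + eps^-1 * `|Q| ^+ 2 - 2 * (`|Q| * `|v1|) =
     eps^-1 * (`|Q| - eps * `|v1|) ^+ 2 by field; rewrite gt_eqF.
  by rewrite mulr_ge0 ?sqr_ge0// invr_ge0 ltW.
have Q0 : 0 <= eps^-1 * Q ^+ 2 by rewrite mulr_ge0 ?sqr_ge0// invr_ge0 ltW.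
have H4 : 2 * (eps * `|v1|) <= eps + eps * v1 ^+ 2.
  rewrite (sq v1) -subr_ge0.
  have -> : eps + eps * `|v1| ^+ 2 - 2 * (eps * `|v1|) = eps * (`|v1| - 1) ^+ 2 by ring.
  by rewrite mulr_ge0 ?sqr_ge0// ltW.
have v2L : v2 ^+ 2 <= L^-1 * ee by rewrite -ler_pdivrMl ?invr_gt0// invrK.
have H5 : eps * ee <= E * ee by rewrite ler_wpM2r.
(* The constant 5: (|r| + 1)^2 <= 2 r^2 + 2, r^2 <= 1 + |Q| and 2 |Q| <= 1 + Q^2 give at most 5 +
   Q^2. *)
have H6 : 2 * ((`|r| + 1) * `|v2|) <= 5 + (E + L^-1) * ee.
  have S1 := sqr_ge0 (`|r| + 1 - `|v2|); have S2 := sqr_ge0 (`|r| - 1).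
  have S3 := sqr_ge0 (`|Q| - 1); have S4 := sqr_ge0 s; have S5 := ler_norm Q.
  have S6 : `|r| ^+ 2 = Q + 1 - s ^+ 2 by rewrite -sq /Q; ring.
  move: v2L h3; rewrite (sq v2) (sq Q) => ? ?; nra.
have H7 : M * (2 * ((`|r| + 1) * `|v2|)) <= M * (5 + (E + L^-1) * ee) by rewrite ler_wpM2l.
have -> : (1 + M * (E + L^-1)) * ee + (E / 2 + 5 * M) = ee + E / 2 + M * (5 + (E + L^-1) * ee).
  by ring.
move: H7; rewrite (_ : M * (2 * _) = 2 * M * (`|r| + 1) * `|v2|); last by ring.
rewrite mulrDl in H1; lra.
Qed.

End potential.

(** Meant for r = |u1|, q = |Q|, s = sqrt eps. Young's inequality with weight s gives 2 q <= s + q^2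
    / s and 2 r q <= s r^2 + q^2 / s, where q^2 / s <= s ee: the outcome is of order sqrt eps. *)
Lemma defect_weighted_le {R : realType} (r q s E ee : R) : 0 <= r -> 0 <= q -> 0 < s ->
  0 <= ee -> q ^+ 2 <= s ^+ 2 * ee -> s ^+ 2 <= E -> r ^+ 2 <= 1 + q ->
  r * q + q <= s * (E + 2) * ee + s * 2.
Proof.
move=> r0 q0 s0 ee0 qs sE rq.
have h1 : 2 * q <= s * (1 + ee).
  by rewrite -(ler_pM2l s0); have := sqr_ge0 (q - s); nra.
have E0 : 0 <= E by apply: le_trans sE; exact: sqr_ge0.
have hE : q ^+ 2 <= E * ee by apply: le_trans qs _; rewrite ler_wpM2r.
have h2 : 2 * (r * q) <= s * (2 + (E + 1) * ee).
  rewrite -(ler_pM2l s0) (_ : s * (s * _) = s ^+ 2 * (2 + (E + 1) * ee)); last by ring.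
  have k1 : 2 * (s * (r * q)) <= s ^+ 2 * r ^+ 2 + q ^+ 2.
    by have := sqr_ge0 (s * r - q); nra.
  have k2 : s ^+ 2 * r ^+ 2 <= s ^+ 2 * (2 + E * ee).
    rewrite ler_wpM2l ?sqr_ge0//; have := sqr_ge0 (q - 1); nra.
  rewrite (_ : s * (2 * (r * q)) = 2 * (s * (r * q))); last by ring.
  by move: k1 k2 qs; rewrite !mulrDr; lra.
have : 0 <= s * (E * ee) by rewrite !mulr_ge0// ltW.
have : 0 <= s * ee by rewrite mulr_ge0// ltW.
lra.
Qed.

Lemma distance_lt_between {R : realType} (x y t r : R) : x < t -> t < y -> y - x < r ->
  `|x - t| < r /\ `|y - t| < r.
Proof. by move=> xt ty yx; rewrite distrC !gtr0_norm; lra. Qed.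

(** * Estimates for the potential and the defect of one map *)

Section potential_bounds.
Context {R : realType}.
Local Notation mu := (@lebesgue_measure R).
Variables (H L C a eps E M : R) (u : R -> R * R).
Hypotheses (H_gt0 : 0 < H) (L_gt0 : 0 < L) (eps_gt0 : 0 < eps) (epsE : eps <= E).
Hypotheses (adm : admissible H a u) (en : (energy H L eps u <= C%:E)%E).
Hypothesis u2M : {in `[- H, H], forall t, `|(u t).2| <= M}.

Local Notation e := (energy_density H L eps u).
Local Notation g1 := (wderiv (- H) H (fst \o u)).
Local Notation g2 := (wderiv (- H) H (snd \o u)).
Local Notation A := (1 + M * (E + L^-1)).
Local Notation B := (E / 2 + 5 * M).

Definition dominating_density t := A * e t + B.

Definition dominating_primitive x := \int[mu]_(t in `]- H, x[) dominating_density t.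

Let M0 : 0 <= M.
Proof.
have HH : H \in `[- H, H] by rewrite in_itv /= lexx andbT; have := H_gt0; lra.
exact: le_trans (u2M _ HH).
Qed.

Let e0 t : 0 <= e t.
Proof. by have [] := energy_density_ge H L eps u t eps_gt0 L_gt0. Qed.

Let A0 : 0 <= A.
Proof.
rewrite addr_ge0// mulr_ge0// addr_ge0 ?invr_ge0 ?ltW//.
exact: lt_le_trans epsE.
Qed.

Let B0 : 0 <= B.
Proof.
by rewrite addr_ge0 ?divr_ge0 ?mulr_ge0// (le_trans _ epsE)// ltW.
Qed.

Let ie : mu.-integrable `]- H, H[ (EFin \o e).
Proof. by have [] := energy_density_integrable _ _ _ _ _ _ eps_gt0 L_gt0 adm en. Qed.

Let iw : mu.-integrable `]- H, H[ (EFin \o dominating_density).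
Proof. exact: integrable_affine. Qed.

Lemma dominating_primitiveB x y : - H <= x -> x < y -> y <= H ->
  dominating_primitive y - dominating_primitive x =
  \int[mu]_(t in `]x, y[) dominating_density t.
Proof.
move=> Hx xy yH; apply: Rintegral_ooB => //.
exact: integrable_oo_subset iw.
Qed.

Lemma dominating_primitive_bound x : - H <= x <= H ->
  0 <= dominating_primitive x <= A * (2 * C) + B * (2 * H).
Proof.
move=> /andP[Hx xH].
have w0 t : 0 <= dominating_density t by rewrite addr_ge0// mulr_ge0.
rewrite Rintegral_ge0//=.
apply: le_trans (le_Rintegral_oo_subset _ _ _ _ _ (lexx _) xH w0 iw) _.
have H0 := H_gt0; rewrite Rintegral_affine//; last lra.
have [_ iC] := energy_density_integrable _ _ _ _ _ _ eps_gt0 L_gt0 adm en.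
by rewrite lerD ?ler_wpM2l//; lra.
Qed.

(** On a short interval the secant slopes are constants that can be moved under the integrals of
    |g1| and |g2| and compared there with the values of u at each t; [increment_chain] then lifts
    the restriction on the length. *)
Lemma potential_dominated x y : - H <= x -> x <= y -> y <= H ->
  `|potential (u y).1 (u y).2 - potential (u x).1 (u x).2| <=
  dominating_primitive y - dominating_primitive x.
Proof.
have [[_ _ c1 c2] _] := adm; have H0 := H_gt0; have M00 := M0.
have [M1 M10 u1M] : exists2 M1, 0 < M1 & {in `[- H, H], forall t, `|(u t).1| <= M1}.
  have [| |c cab cmax] := @EVT_max R (fun x => `|(u x).1|) (- H) H; first lra.
    by move=> z; apply: cvg_norm; exact: c1.
  by exists (`|(u c).1| + 1) => [|z /cmax zc]; [rewrite ltr_wpDl|rewrite (le_trans zc)// lerDl].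
pose N := 2 * (M1 + M).
have N0 : 0 < N by rewrite mulr_gt0// ltr_pwDl.
(* [eps / N] makes the slope error at most eps, and 1 gives |(u x).1| <= |(u t).1| + 1. The bound M1
   belongs to this map and may blow up with eps; it affects only the length scale. *)
pose d := Num.min 1 (eps / N).
have d0 : 0 < d by rewrite lt_min ltr01 divr_gt0.
have d1 : d <= 1 by rewrite ge_min lexx.
have dN : N * d <= eps by rewrite mulrC -ler_pdivlMr// ge_min lexx orbT.
have [r1 r10 u1c] := within_continuous_itv_uniform c1 _ d0.
have [r2 r20 u2c] := within_continuous_itv_uniform c2 _ d0.
have r0 : 0 < Num.min r1 r2 by rewrite lt_min r10 r20.
apply: (increment_chain _ _ _ (fun x => potential (u x).1 (u x).2) _ r0).
move=> {}x {}y Hx xy yH; rewrite lt_min => /andP[yx1 yx2].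
rewrite dominating_primitiveB// potential_increment.
have xab : x \in `[- H, H] by rewrite in_itv /= Hx (le_trans (ltW xy) yH).
have yab : y \in `[- H, H] by rewrite in_itv /= yH (le_trans Hx (ltW xy)).
have [i1 i2] := component_increments _ _ _ _ _ _ L_gt0 eps_gt0 adm en _ _ Hx xy yH.
set s1 := slope1 _ _ _; set s2 := (u x).1 * _.
have [j1 j2] := wderivs_integrable _ _ _ _ _ _ L_gt0 eps_gt0 adm en.
have {}j1 := integrable_norm (integrable_oo_subset _ _ _ _ _ Hx yH j1).
have {}j2 := integrable_norm (integrable_oo_subset _ _ _ _ _ Hx yH j2).
have k1 : mu.-integrable `]x, y[ (EFin \o (fun t => `|s1| * `|g1 t|)).
  exact: (@integrableZl _ _ R mu `]x, y[%classic (measurable_itv _) `|s1| _ j1).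
have k2 : mu.-integrable `]x, y[ (EFin \o (fun t => `|s2| * `|g2 t|)).
  exact: (@integrableZl _ _ R mu `]x, y[%classic (measurable_itv _) `|s2| _ j2).
apply: (@le_trans _ _ (\int[mu]_(t in `]x, y[) (`|s1| * `|g1 t| + `|s2| * `|g2 t|))).
  rewrite RintegralD; [|exact: measurable_itv|exact: k1|exact: k2].
  rewrite !RintegralZl//.
  apply: le_trans (ler_normD _ _) _; rewrite (normrM s1) (normrM s2).
  by apply: lerD; [apply: (ler_wpM2l _ i1)|apply: (ler_wpM2l _ i2)]; exact: normr_ge0.
apply: le_Rintegral => //.
- exact: (@integrableD _ _ R mu `]x, y[%classic (measurable_itv _) _ _ k1 k2).
- exact: integrable_oo_subset iw.
move=> t; rewrite /= in_itv /= => /andP[xt ty].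
have tab : t \in `[- H, H] by rewrite in_itv /= (le_trans Hx (ltW xt)) (le_trans (ltW ty) yH).
have [_ h3 h1 h2] := energy_density_ge H L eps u t eps_gt0 L_gt0.
have [xt1 yt1] := distance_lt_between _ _ _ _ xt ty yx1.
have [xt2 yt2] := distance_lt_between _ _ _ _ xt ty yx2.
have D1x := ltW (u1c _ _ xab tab xt1); have D1y := ltW (u1c _ _ yab tab yt1).
have D2x := ltW (u2c _ _ xab tab xt2); have D2y := ltW (u2c _ _ yab tab yt2).
apply: (slopes_weighted_le _ _ _ eps _ _ _ _ _ (u t).1 (u t).2) => //.
- have := slope1_defect _ _ _ _ _ _ _ _ (u1M _ xab) (u1M _ yab) (u1M _ tab) (u2M _ yab)
    (u2M _ tab) D1x D1y D2y.
  rewrite -/s1 -/N => h.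
  rewrite -{1}(subrK ((u t).1 ^+ 2 + (u t).2 ^+ 2 - 1) s1) (le_trans (ler_normD _ _))//.
  by rewrite addrC lerD2l (le_trans h dN).
- have h4 : `|(u x).1| <= `|(u t).1| + 1.
    rewrite -[(u x).1](subrK (u t).1) (le_trans (ler_normD _ _))//.
    by rewrite addrC lerD2l (le_trans D1x d1).
  have h5 : `|(u x).2 + (u y).2| <= 2 * M.
    by rewrite (le_trans (ler_normD _ _))// mulr_natl mulr2n lerD// u2M.
  by rewrite /s2 normrM mulrC ler_pM.
Qed.

(** The boundary condition anchors the potential at - H independently of eps; oddness in the first
    variable makes the sign of the boundary value immaterial. *)
Lemma potential_bound x : - H <= x <= H ->
  `|potential (u x).1 (u x).2| <=
  `|potential (Num.sqrt (1 - a ^+ 2)) a| + (A * (2 * C) + B * (2 * H)).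
Proof.
move=> /andP[Hx xH]; have [_ [uH _]] := adm; have H0 := H_gt0.
have h1 := potential_dominated _ _ (lexx _) Hx xH.
have /dominating_primitive_bound/andP[_ h2] : - H <= x <= H by rewrite Hx.
have /dominating_primitive_bound/andP[h3 _] : - H <= - H <= H by rewrite lexx; lra.
have -> : `|potential (Num.sqrt (1 - a ^+ 2)) a| = `|potential (u (- H)).1 (u (- H)).2|.
  by rewrite uH /= -normrN; congr (`|_|); rewrite /potential; ring.
have := ler_normD (potential (u x).1 (u x).2 - potential (u (- H)).1 (u (- H)).2)
  (potential (u (- H)).1 (u (- H)).2).
rewrite subrK; lra.
Qed.

Lemma defect_small_L1 :
  mu.-integrable `]- H, H[ (EFin \o (fun t => `|(u t).1 * defect u t| + `|defect u t|)) /\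
  \int[mu]_(t in `]- H, H[) (`|(u t).1 * defect u t| + `|defect u t|) <=
  Num.sqrt eps * ((E + 2) * (2 * C) + 2 * (2 * H)).
Proof.
have [[_ _ c1 c2] _] := adm; have H0 := H_gt0;
have m1 := measurable_within_continuous _ _ _ c1.
have m2 := measurable_within_continuous _ _ _ c2.
have mQ : measurable_fun `]- H, H[ (defect u).
  by apply: measurable_funB => //; apply: measurable_funD; exact: measurable_funX.
have mh : measurable_fun `]- H, H[ (fun t => `|(u t).1 * defect u t| + `|defect u t|).
  apply: measurable_funD; last exact: measurableT_comp.
  by apply: measurableT_comp => //; exact: measurable_funM.
set s := Num.sqrt eps.
have s0 : 0 < s by rewrite sqrtr_gt0.
have ss : s ^+ 2 = eps by rewrite sqr_sqrtr// ltW.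
set h := (X in EFin \o X); have mf : measurable_fun `]- H, H[ h by exact: mh.
have fe : {in `]- H, H[, forall t, `|h t| <= (s * (E + 2)) * e t + s * 2}.
  move=> t _; rewrite /h ger0_norm ?addr_ge0// normrM.
  have [_ ed _ _] := energy_density_ge H L eps u t eps_gt0 L_gt0.
  apply: defect_weighted_le => //; first by rewrite real_normK ?num_real// ss.
    by rewrite ss.
  rewrite real_normK ?num_real// -lerBlDl; apply: le_trans (ler_norm _).
  by rewrite /defect addrAC lerDl sqr_ge0.
split; first exact: integrable_le_affine fe ie.
apply: (@le_trans _ _ ((s * (E + 2)) * \int[mu]_(t in `]- H, H[) e t + (s * 2) * (H - - H))).
  apply: le_trans (le_Rintegral_affine _ _ _ _ _ _ _ mf fe ie); last lra.
  by apply: le_Rintegral => //; [exact: integrable_le_affine fe ie| |move=> t _; exact: ler_norm];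
    apply: integrable_norm; exact: integrable_le_affine fe ie.
have [_ iC] := energy_density_integrable _ _ _ _ _ _ eps_gt0 L_gt0 adm en.
have E0 : 0 <= E by apply: le_trans epsE; exact: ltW.
have hC : (E + 2) * \int[mu]_(t in `]- H, H[) e t <= (E + 2) * (2 * C).
  by rewrite ler_wpM2l// addr_ge0.
rewrite opprK -!mulrA -mulrDr ler_wpM2l ?(ltW s0)// lerD//.
by rewrite [2 * H]mulr_natl mulr2n.
Qed.

End potential_bounds.

(** * Tools for passing to the limit *)

Section limits.
Context {R : realType}.
Local Notation mu := (@lebesgue_measure R).
Implicit Types (a b p q v w x y K M : R) (f g : R -> R).

Lemma bounded_convergence_L1 a b M (F : nat -> R -> R) g :
  (forall n, measurable_fun `]a, b[ (F n)) -> measurable_fun `]a, b[ g ->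
  (forall n, {in `]a, b[, forall x, `|F n x| <= M}) ->
  countable [set x | a < x < b /\ ~ (F n x @[n --> \oo] --> g x)] ->
  \int[mu]_(x in `]a, b[) `|F n x - g x| @[n --> \oo] --> (0 : R).
Proof.
move=> mF mg FM cF.
have [] := @dominated_convergence _ _ R mu `]a, b[%classic (measurable_itv _)
  (fun n => EFin \o F n) (EFin \o g) (fun=> M%:E).
- move=> n; apply/measurable_EFinP; exact: mF.
- exact/measurable_EFinP.
- exists [set x | a < x < b /\ ~ (F n x @[n --> \oo] --> g x)]; split.
  + exact: countable_measurable.
  + exact: countable_lebesgue_measure0.
  + move=> x /= nx; apply: contrapT => h; apply: nx => xab; apply: cvg_EFin.
      by near=> n.
    apply: contrapT => h'; apply: h; split => //.
- by apply: (integrable_oo_bounded _ _ `|M|) => // x _.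
- by apply: aeW => x n xab; rewrite lee_fin; exact: FM.
- by move=> _ h _; apply: fine_cvg h.
Unshelve. all: by end_near. Qed.

Lemma cbrt_subproof : exists c : R -> R, forall x, c x ^+ 3 = x.
Proof.
exists (fun x => if 0 <= x then x `^ 3^-1 else - ((- x) `^ 3^-1)) => x.
have h y : 0 <= y -> (y `^ 3^-1) ^+ 3 = y.
  by move=> y0; rewrite -powR_mulrn ?powR_ge0// -powRrM mulVf// powRr1.
case: ifPn => [/h //|]; rewrite -ltNge => x0.
by rewrite exprNn h ?oppr_ge0 ?ltW// -signr_odd /= expr1 mulN1r opprK.
Qed.

Definition cbrt : R -> R := sval (cid cbrt_subproof).

Lemma cbrtK x : cbrt x ^+ 3 = x.
Proof. exact: (svalP (cid cbrt_subproof)). Qed.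

(** With |p - v| factored out, the claim is (p - v)^2 <= 4 (p^2 + p v + v^2), whose sides differ by
    3 (p + v)^2. *)
Lemma cube_distance_le p v : `|p - v| ^+ 3 <= 4 * `|p ^+ 3 - v ^+ 3|.
Proof.
have -> : p ^+ 3 - v ^+ 3 = (p - v) * (p ^+ 2 + p * v + v ^+ 2) by ring.
rewrite normrM exprS [leRHS]mulrCA ler_wpM2l// real_normK ?num_real//.
apply: le_trans (_ : 4 * (p ^+ 2 + p * v + v ^+ 2) <= _); last by rewrite ler_wpM2l// ler_norm.
by rewrite -subr_ge0 (_ : _ - _ = 3 * (p + v) ^+ 2); [rewrite mulr_ge0// sqr_ge0|ring].
Qed.

(** [cbrt] is known only through its cube, so monotonicity comes from factoring a difference of
    cubes; it is what makes [cbrt] measurable. *)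
Lemma cbrt_nondecreasing : nondecreasing_fun cbrt.
Proof.
move=> x y xy; rewrite leNgt; apply/negP => h.
suff : y < x by rewrite ltNge xy.
rewrite -(cbrtK x) -(cbrtK y) -subr_gt0.
have -> : cbrt x ^+ 3 - cbrt y ^+ 3 =
  (cbrt x - cbrt y) * ((cbrt x - cbrt y) ^+ 2 + 3 * (cbrt x + cbrt y) ^+ 2) / 4 by field.
have d0 : 0 < cbrt x - cbrt y by rewrite subr_gt0.
apply: divr_gt0 => //; apply: mulr_gt0 => //; apply: ltr_pwDl.
  exact: exprn_gt0.
by rewrite mulr_ge0// sqr_ge0.
Qed.

Lemma measurable_cbrt : measurable_fun setT cbrt.
Proof. by apply: nondecreasing_measurable => //; exact: cbrt_nondecreasing. Qed.

Lemma cube_bound v K : `|v ^+ 3| <= K -> `|v| <= 1 + K.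
Proof.
rewrite normrX; have [v1|v1] := leP `|v| 1 => h; first by rewrite (le_trans v1)// lerDl (le_trans _ h)// exprn_ge0.
rewrite (@le_trans _ _ (`|v| ^+ 3))//; last by rewrite (le_trans h)// lerDr.
by rewrite exprS ler_peMr// exprn_ege1// ltW.
Qed.

Lemma Lp_norm3E a b f : mu.-integrable `]a, b[ (EFin \o (fun x => `|f x| ^+ 3)) ->
  Lp_norm a b 3%:E f = ((\int[mu]_(x in `]a, b[) `|f x| ^+ 3) `^ 3^-1)%:E.
Proof.
move=> fi; rewrite /Lp_norm unlock -poweR_EFin; congr (poweR _ _).
rewrite fineK; last exact: integrable_fin_num.
rewrite [RHS]integral_mkcond; apply: eq_integral => x _.
rewrite /= !patchE; case: ifPn => _ /=; first by rewrite -powR_mulrn.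
by rewrite normr0 powR0.
Qed.

Lemma Lp_itv3_bounded a b K f : measurable_fun `]a, b[ f ->
  {in `]a, b[, forall x, `|f x| <= K} -> Lp_itv a b 3%:E f.
Proof.
move=> mf fK; rewrite /Lp_itv inE; apply/andP; split; rewrite inE /=.
  by apply/(measurable_restrictT _ _).1.
rewrite /finite_norm -/(Lp_norm a b 3%:E f) Lp_norm3E ?ltry//.
apply: (integrable_oo_bounded _ _ (K ^+ 3)) => [|x xab].
  by apply: measurable_funX; exact: measurableT_comp.
by rewrite normrX normr_id lerXn2r ?nnegrE// ?fK// (le_trans _ (fK _ xab)).
Qed.

(* The free parameter d absorbs the powers of |p - v| below the third. *)
Lemma limit_defect_le K M d v w p q : 0 <= K -> 0 < d -> d <= 1 ->
  `|v| <= K -> `|w| <= M -> `|q| <= M ->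
  `|v ^+ 2 + w ^+ 2 - 1| <= `|p ^+ 2 + q ^+ 2 - 1| + 2 * M * `|q - w| +
    (1 + 2 * K) * (d + `|p - v| ^+ 3 / d ^+ 2).
Proof.
move=> K0 d0 d1 vK wM qM; set t := `|p - v|.
have t0 : 0 <= t by exact: normr_ge0.
have T1 : t <= d + t ^+ 3 / d ^+ 2.
  have [td|dt] := leP t d; first by rewrite (le_trans td)// lerDl divr_ge0 ?exprn_ge0// ltW.
  rewrite (@le_trans _ _ (t ^+ 3 / d ^+ 2)) ?lerDr 1?ltW//.
  by rewrite ltr_pdivlMr ?exprn_gt0// [ltRHS]exprS ltr_pM2l ?(lt_trans d0)// ltr_pXn2r ?nnegrE// ltW.
have T2 : t ^+ 2 <= d + t ^+ 3 / d ^+ 2.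
  have [td|dt] := leP t d.
    rewrite (@le_trans _ _ d)//; last by rewrite lerDl divr_ge0 ?exprn_ge0// ltW.
    by rewrite expr2 (le_trans (ler_wpM2l t0 td))// ler_piMl ?(ltW d0)// (le_trans td).
  have tt : 0 < t by exact: lt_trans dt.
  rewrite (@le_trans _ _ (t ^+ 3 / d ^+ 2)) ?lerDr 1?ltW//.
  rewrite ltr_pdivlMr ?exprn_gt0// [ltRHS]exprSr ltr_pM2l ?exprn_gt0//.
  by rewrite expr2 (le_lt_trans _ dt)// ler_piMr// ltW.
have V : `|v ^+ 2 - p ^+ 2| <= t ^+ 2 + 2 * K * t.
  have -> : v ^+ 2 - p ^+ 2 = - (p - v) ^+ 2 - 2 * v * (p - v) by ring.
  rewrite (le_trans (ler_normB _ _))// normrN normrX -/t lerD2l !normrM -/t.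
  by rewrite ger0_norm// ler_wpM2r// ler_wpM2l.
have W : `|w ^+ 2 - q ^+ 2| <= 2 * M * `|q - w|.
  have -> : w ^+ 2 - q ^+ 2 = - ((w + q) * (q - w)) by ring.
  rewrite normrN normrM ler_wpM2r// (le_trans (ler_normD _ _))//.
  by rewrite mulr_natl mulr2n lerD.
have -> : v ^+ 2 + w ^+ 2 - 1 = (p ^+ 2 + q ^+ 2 - 1) + (w ^+ 2 - q ^+ 2) + (v ^+ 2 - p ^+ 2) by ring.
rewrite (le_trans (ler_normD _ _))// lerD//.
  by rewrite (le_trans (ler_normD _ _))// lerD2l.
rewrite (le_trans V)// [leRHS]mulrDl mul1r; apply: lerD => //.
by rewrite ler_wpM2l// mulr_ge0.
Qed.

Lemma Rintegral_eq0_ae a b f : measurable_fun `]a, b[ f ->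
  mu.-integrable `]a, b[ (EFin \o f) ->
  \int[mu]_(x in `]a, b[) `|f x| = 0 -> {ae mu, forall x, x \in `]a, b[ -> f x = 0}.
Proof.
move=> mf fi f0.
have h : (\int[mu]_(x in `]a, b[) `|(EFin \o f) x| = 0)%E.
  have ifin := @integrable_fin_num _ _ R mu _ (measurable_itv _) _ (integrable_norm fi).
  rewrite -[LHS]/(\int[mu]_(x in `]a, b[) (`|f x|)%:E)%E -[LHS](fineK ifin).
  by rewrite -[fine _]/(\int[mu]_(x in `]a, b[) `|f x|) f0.
have mEf : measurable_fun `]a, b[%classic (EFin \o f) by exact/measurable_EFinP.
have := (ae_eq_integral_abs mu (measurable_itv _) mEf).1 h.
by apply: filterS => x fx xab; have [] := fx xab.
Qed.

Lemma increasing_ge_id (k : nat -> nat) : {homo k : m n / (m < n)%N} -> forall n, (n <= k n)%N.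
Proof. by move=> hk; elim=> // n IH; apply: leq_ltn_trans IH (hk _ _ (ltnSn n)). Qed.

Lemma increasing_cvg_infty (k : nat -> nat) : {homo k : m n / (m < n)%N} -> k @ \oo --> \oo.
Proof.
move=> hk A [N _ NA]; exists N => // n /= Nn; apply: NA => /=.
exact: leq_trans Nn (increasing_ge_id _ hk _).
Qed.

End limits.

(** * Passage to the limit, with [u] already the extracted subsequence *)

Section sequence.
Context {R : realType}.
Local Notation mu := (@lebesgue_measure R).
Variables (H L C a E M B : R) (eps : nat -> R) (u : nat -> R -> R * R).
Hypotheses (H_gt0 : 0 < H) (L_gt0 : 0 < L).
Hypotheses (eps_gt0 : forall n, 0 < eps n) (epsE : forall n, eps n <= E).
Hypothesis eps_cvg0 : eps n @[n --> \oo] --> (0 : R).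
Hypothesis adm : forall n, admissible H a (u n).
Hypothesis en : forall n, (energy H L (eps n) (u n) <= C%:E)%E.

Local Notation pot n := (fun x => potential (u n x).1 (u n x).2).

Variables (G V w : R -> R).
Hypothesis pot_bound : forall n, {in `[- H, H], forall x, `|pot n x| <= B}.
Hypothesis G_bound : {in `[- H, H], forall x, `|G x| <= B}.
Hypothesis G_dominated : forall x y, - H <= x -> x <= y -> y <= H -> `|G y - G x| <= V y - V x.
Hypothesis pot_cvg :
  countable [set x | - H < x < H /\ ~ (pot n x @[n --> \oo] --> G x)].
Hypothesis u2_cvg : forall e, 0 < e ->
  \forall n \near \oo, {in `[- H, H], forall x, `|(u n x).2 - w x| < e}.
Hypothesis u2_bound : forall n, {in `[- H, H], forall x, `|(u n x).2| <= M}.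
Hypothesis u2_holder : forall n, {in `[- H, H] &, forall x y,
  `|(u n x).2 - (u n y).2| <= (C / L + 2^-1) * Num.sqrt `|x - y|}.

Local Notation K := (C / L + 2^-1).

(* On |(p, q)| = 1 the potential is - 2/3 p^3. *)
Definition limit1 x := cbrt (- (3 / 2) * G x).
Local Notation v := limit1.

Lemma C_ge0 : 0 <= C.
Proof.
have [_ iC] := energy_density_integrable _ _ _ _ _ _ (eps_gt0 0) L_gt0 (adm 0) (en 0).
suff : 0 <= 2 * C by rewrite pmulr_rge0.
apply: le_trans iC; apply: Rintegral_ge0 => x _.
by have [] := energy_density_ge H L (eps 0) (u 0) x (eps_gt0 0) L_gt0.
Qed.

Lemma holder_constant_gt0 : 0 < K.
Proof. by rewrite ltr_wpDl ?invr_gt0// divr_ge0 ?C_ge0// ltW. Qed.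

Lemma limit2_bound : {in `[- H, H], forall x, `|w x| <= M}.
Proof.
move=> x xH; apply/ler_addgt0Pl => e e0.
have [n wn] := filter_ex (u2_cvg _ e0).
rewrite -(subrK (u n x).2 (w x)) (le_trans (ler_normD _ _))//.
by rewrite lerD ?u2_bound// distrC ltW// wn.
Qed.

Lemma limit2_holder : {in `[- H, H] &, forall x y, `|w x - w y| <= K * Num.sqrt `|x - y|}.
Proof.
move=> x y xH yH; apply/ler_addgt0Pl => e e0.
have e20 : 0 < e / 2 by rewrite divr_gt0.
have [n wn] := filter_ex (u2_cvg _ e20).
have := u2_holder n _ _ xH yH; have := wn _ xH; have := wn _ yH.
set k := K * _; rewrite ltr_norml ltr_norml !ler_norml.
move=> /andP[? ?] /andP[? ?] /andP[? ?]; apply/andP; split; lra.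
Qed.

(** The limit inherits the Hölder-1/2 constant K, so the differences have constant 2 K and tend to 0
    uniformly, as [holder_norm_small] requires. *)
Lemma limit2_norm_cvg gamma : 0 < gamma < 2^-1 ->
  holder_norm `[- H, H] gamma w \is a fin_num /\
  (holder_norm `[- H, H] gamma (fun y => (u n y).2 - w y) @[n --> \oo] --> (0 : \bar R)%E).
Proof.
move=> /[dup] /andP[g0 g2] g; have K0 := holder_constant_gt0.
have HH : - H < H by rewrite gtrN.
split.
  exact: (holder_norm_fin_num _ _ _ _ _ _ HH (ltW g2) (ltW K0) limit2_bound limit2_holder).
have D n : {in `[- H, H] &, forall x y,
    `|((u n x).2 - w x) - ((u n y).2 - w y)| <= 2 * K * Num.sqrt `|x - y|}.
  move=> x y xH yH; rewrite opprD addrACA -opprD.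
  rewrite (le_trans (ler_normB _ _))// -mulrA mulr_natl mulr2n lerD ?u2_holder//.
  exact: limit2_holder.
have K20 : 0 < 2 * K by rewrite mulr_gt0.
apply/fine_cvgP; split.
  have [s s0 sP] := holder_norm_small _ _ _ _ _ HH g K20 (ltr01 : 0 < (1 : R)).
  apply: filterS (u2_cvg _ s0) => n wn.
  have /andP[h0 h1] := sP _ (fun x xH => ltW (wn x xH)) (D n).
  by rewrite ge0_fin_numE// (le_lt_trans h1)// ltry.
apply/cvgrPdist_le => /= e e0.
have [s s0 sP] := holder_norm_small _ _ _ _ _ HH g K20 e0.
apply: filterS (u2_cvg _ s0) => n wn.
have /andP[h0 h1] := sP _ (fun x xH => ltW (wn x xH)) (D n).
rewrite sub0r normrN ger0_norm ?fine_ge0//.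
by rewrite -lee_fin fineK// ge0_fin_numE// (le_lt_trans h1)// ltry.
Qed.

Lemma measurable_limit_potential : measurable_fun `]- H, H[ G.
Proof. exact: increment_dominated_measurable G_dominated. Qed.

Lemma measurable_limit1 : measurable_fun `]- H, H[ v.
Proof.
apply: (@measurableT_comp _ _ _ _ _ _ cbrt); first exact: measurable_cbrt.
by apply: measurable_funM => //; exact: measurable_limit_potential.
Qed.

Lemma limit1_bound : {in `[- H, H], forall x, `|v x| <= 1 + 3 / 2 * B}.
Proof.
move=> x xH; apply: cube_bound; rewrite cbrtK normrM normrN (@ger0_norm _ (3 / 2)) ?divr_ge0//.
by rewrite ler_wpM2l ?divr_ge0// G_bound.
Qed.

Lemma limit1_BV : BV_space (- H) H (fun y => v y ^+ 3).
Proof.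
have -> : (fun y => v y ^+ 3) = (fun y => - (3 / 2) * G y) by apply/funext => y; rewrite cbrtK.
apply: (@dominated_increment_BV _ _ _ (3 / 2 * B) _ (fun x => 3 / 2 * V x)).
- by rewrite gtrN.
- move=> x y Hx xy yH; rewrite -!mulrBr normrM normrN (@ger0_norm _ (3 / 2)) ?divr_ge0//.
  by rewrite ler_wpM2l ?divr_ge0// G_dominated.
- move=> x xH; rewrite normrM normrN (@ger0_norm _ (3 / 2)) ?divr_ge0//.
  by rewrite ler_wpM2l ?divr_ge0// G_bound.
Qed.

(** The factor 6 is 4 from the cube inequality times 3/2 from u1^3 = - 3/2 (potential - u1 Q). The
    added |Q| is slack, so that one family [defect_sum] also serves for the unit length of the
    limit. *)
Lemma cube_distance_potential_le n x :
  `|(u n x).1 - v x| ^+ 3 <=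
  6 * `|pot n x - G x| + 6 * (`|(u n x).1 * defect (u n) x| + `|defect (u n) x|).
Proof.
rewrite (le_trans (cube_distance_le _ _))// cbrtK.
have -> : (u n x).1 ^+ 3 - - (3 / 2) * G x =
    - (3 / 2) * (pot n x - G x - (u n x).1 * defect (u n) x).
  by rewrite /potential /defect; field.
rewrite normrM normrN (@ger0_norm _ (3 / 2)) ?divr_ge0// mulrA.
have -> : 4 * (3 / 2) = 6 :> R by field.
rewrite -mulrDr ler_wpM2l// (le_trans (ler_normB _ _))// lerD2l.
by rewrite lerDl.
Qed.

Lemma continuous_components n :
  {within `[- H, H], continuous (fun x => (u n x).1)} /\
  {within `[- H, H], continuous (fun x => (u n x).2)}.
Proof. by have [[_ _ c1 c2] _] := adm n. Qed.

Lemma measurable_components n :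
  measurable_fun `]- H, H[ (fun x => (u n x).1) /\
  measurable_fun `]- H, H[ (fun x => (u n x).2).
Proof.
have [c1 c2] := continuous_components n.
by split; exact: measurable_within_continuous.
Qed.

Lemma measurable_potential n : measurable_fun `]- H, H[ (pot n).
Proof.
have [m1 m2] := measurable_components n.
apply: measurable_funB; first by apply: measurable_funM => //; exact: measurable_funX.
apply: measurable_funM => //; apply: measurable_funB => //; exact: measurable_funX.
Qed.

Lemma integrable_potential_distance n :
  mu.-integrable `]- H, H[ (EFin \o (fun x => `|pot n x - G x|)).
Proof.
apply: (integrable_oo_bounded _ _ (B + B)).
  apply: measurableT_comp => //; apply: measurable_funB.
    exact: measurable_potential.
  exact: measurable_limit_potential.
move=> x /subset_itv_oo_cc xH; rewrite normr_id (le_trans (ler_normB _ _))//.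
by rewrite lerD ?G_bound ?pot_bound.
Qed.

Let defect_sum n x := `|(u n x).1 * defect (u n) x| + `|defect (u n) x|.

Let defect_sum_integrable n : mu.-integrable `]- H, H[ (EFin \o defect_sum n).
Proof.
by have [] := defect_small_L1 _ _ _ _ _ _ _ H_gt0 L_gt0 (eps_gt0 n) (epsE n) (adm n) (en n).
Qed.

Lemma defect_sum_cvg0 :
  \int[mu]_(x in `]- H, H[) defect_sum n x @[n --> \oo] --> (0 : R).
Proof.
set c := (E + 2) * (2 * C) + 2 * (2 * H).
have sc : Num.sqrt (eps n) * c @[n --> \oo] --> (0 : R).
  rewrite -(mul0r c); apply: cvgM; last exact: cvg_cst.
  rewrite -sqrtr0; apply: cvg_comp eps_cvg0 _; exact: sqrt_continuous.
apply: (squeeze_cvgr _ (cvg_cst 0) sc); apply: nearW => n.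
rewrite Rintegral_ge0 => [|x _]; last by rewrite addr_ge0.
by have [] := defect_small_L1 _ _ _ _ _ _ _ H_gt0 L_gt0 (eps_gt0 n) (epsE n) (adm n) (en n).
Qed.

Let measurable_cube n : measurable_fun `]- H, H[ (fun x => `|(u n x).1 - v x| ^+ 3).
Proof.
have [m1 _] := measurable_components n.
apply: measurable_funX; apply: measurableT_comp => //.
by apply: measurable_funB => //; exact: measurable_limit1.
Qed.

Let integrable_cube_bound n : mu.-integrable `]- H, H[ (EFin \o
  (fun x => 6 * `|pot n x - G x| + 6 * defect_sum n x)).
Proof.
have i1 := @integrableZl _ _ R mu _ (measurable_itv _) 6 _ (integrable_potential_distance n).
have i2 := @integrableZl _ _ R mu _ (measurable_itv _) 6 _ (defect_sum_integrable n).
exact: (@integrableD _ _ R mu _ (measurable_itv _) _ _ i1 i2).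
Qed.

Lemma integrable_cube n :
  mu.-integrable `]- H, H[ (EFin \o (fun x => `|(u n x).1 - v x| ^+ 3)).
Proof.
apply: le_integrable (integrable_cube_bound n) => //.
  by apply/measurable_EFinP; exact: measurable_cube.
move=> x _ /=; rewrite lee_fin normrX normr_id (le_trans (cube_distance_potential_le n x))//.
exact: ler_norm.
Qed.

Lemma cube_L1_cvg0 :
  \int[mu]_(x in `]- H, H[) (`|(u n x).1 - v x| ^+ 3) @[n --> \oo] --> (0 : R).
Proof.
have c1 : \int[mu]_(x in `]- H, H[) `|pot n x - G x| @[n --> \oo] --> (0 : R).
  apply: (bounded_convergence_L1 _ _ B) => //.
  - exact: measurable_potential.
  - exact: measurable_limit_potential.
  - by move=> n x /subset_itv_oo_cc xH; exact: pot_bound.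
have c : 6 * \int[mu]_(x in `]- H, H[) `|pot n x - G x| +
    6 * \int[mu]_(x in `]- H, H[) defect_sum n x @[n --> \oo] --> (0 : R).
  have c6 : (fun _ : nat => 6 : R) @ \oo --> (6 : R) by exact: cvg_cst.
  have := cvgD (cvgM c6 c1) (cvgM c6 defect_sum_cvg0).
  by rewrite mulr0 addr0; apply.
apply: (squeeze_cvgr _ (cvg_cst 0) c); apply: nearW => n.
rewrite Rintegral_ge0 => [|x _]; last exact: exprn_ge0.
have i1 := @integrableZl _ _ R mu _ (measurable_itv _) 6 _ (integrable_potential_distance n).
have i2 := @integrableZl _ _ R mu _ (measurable_itv _) 6 _ (defect_sum_integrable n).
rewrite -RintegralZl//; last exact: integrable_potential_distance.
rewrite -RintegralZl//.
rewrite -RintegralD; [|exact: measurable_itv|exact: i1|exact: i2].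
apply: le_Rintegral.
- exact: measurable_itv.
- exact: integrable_cube.
- exact: integrable_cube_bound.
by move=> x _; exact: cube_distance_potential_le.
Qed.

Lemma limit1_L3 : Lp_itv (- H) H 3%:E v /\
  (Lp_norm (- H) H 3%:E (fun y => (u n y).1 - v y) @[n --> \oo] --> (0 : \bar R)%E).
Proof.
split.
  apply: (Lp_itv3_bounded _ _ (1 + 3 / 2 * B)); first exact: measurable_limit1.
  by move=> x /subset_itv_oo_cc; exact: limit1_bound.
have -> : (fun n => Lp_norm (- H) H 3%:E (fun y => (u n y).1 - v y)) =
    (fun n => ((\int[mu]_(x in `]- H, H[) (`|(u n x).1 - v x| ^+ 3)) `^ 3^-1)%:E).
  by apply/funext => n; rewrite Lp_norm3E//; exact: integrable_cube.
apply: cvg_EFin; first exact: nearW.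
apply/cvgrPdist_le => /= e e0.
have e30 : 0 < e ^+ 3 by rewrite exprn_gt0.
move/cvgrPdist_le/(_ _ e30) : cube_L1_cvg0; apply: filterS => n /=.
rewrite !sub0r !normrN ger0_norm => [h|]; last by apply: Rintegral_ge0 => x _; exact: exprn_ge0.
rewrite ger0_norm ?powR_ge0// -(@ler_pXn2r _ 3) ?nnegrE ?powR_ge0// ?(ltW e0)//.
rewrite -[leLHS]powR_mulrn ?powR_ge0// -powRrM mulVf// powRr1//.
by apply: Rintegral_ge0 => x _; exact: exprn_ge0.
Qed.

Lemma measurable_limit2 : measurable_fun `]- H, H[ w.
Proof.
apply: (measurable_fun_cvg (h := fun n x => (u n x).2)) => [n|x /subset_itv_oo_cc xH].
  by have [] := measurable_components n.
apply/cvgrPdist_lt => e e0; apply: filterS (u2_cvg _ e0) => n wn.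
by rewrite distrC; exact: wn.
Qed.

Lemma limit_defect_L1 :
  mu.-integrable `]- H, H[ (EFin \o (fun x => v x ^+ 2 + w x ^+ 2 - 1)) /\
  \int[mu]_(x in `]- H, H[) `|v x ^+ 2 + w x ^+ 2 - 1| = 0.
Proof.
have oH : 0 \in `[- H, H] by rewrite in_itv /= oppr_le0 ltW//= ltW.
have K0 : 0 <= 1 + 3 / 2 * B by exact: le_trans (limit1_bound _ oH).
have M0 : 0 <= M by exact: le_trans (limit2_bound _ oH).
set k := 1 + 2 * (1 + 3 / 2 * B).
have k1 : 1 <= k by rewrite lerDl mulr_ge0.
have k0 : 0 < k by exact: lt_le_trans k1.
have mS : measurable_fun `]- H, H[ (fun x => v x ^+ 2 + w x ^+ 2 - 1).
  apply: measurable_funB => //; apply: measurable_funD; apply: measurable_funX.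
    exact: measurable_limit1.
  exact: measurable_limit2.
have iS : mu.-integrable `]- H, H[ (EFin \o (fun x => v x ^+ 2 + w x ^+ 2 - 1)).
  apply: (integrable_oo_bounded _ _ ((1 + 3 / 2 * B) ^+ 2 + M ^+ 2 + 1)) => //.
  move=> x /subset_itv_oo_cc xH; rewrite (le_trans (ler_normB _ _))// normr1 lerD2r.
  rewrite (le_trans (ler_normD _ _))// !normrX lerD// lerXn2r ?nnegrE//.
    exact: limit1_bound.
  exact: limit2_bound.
split => //; apply/eqP; rewrite eq_le; apply/andP; split; last by exact: Rintegral_ge0.
apply/ler_addgt0Pl => e e0; rewrite addr0.
have e30 : 0 < e / 3 by rewrite divr_gt0.
(* The coefficient of d after integration: 2 M from the second components and k from the free
   parameter, times the length of the interval. *)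
pose c := (2 * M + k) * (2 * H).
have c0 : 0 < c by rewrite !mulr_gt0// ltr_wpDl// mulr_ge0.
pose d := Num.min 1 (e / 3 / c).
have d0 : 0 < d by rewrite lt_min ltr01 divr_gt0.
have d1 : d <= 1 by rewrite ge_min lexx.
have dc : c * d <= e / 3 by rewrite mulrC -ler_pdivlMr// ge_min lexx orbT.
pose l := k / d ^+ 2.
have l0 : 0 < l by rewrite divr_gt0// exprn_gt0.
have [n [wn [Dn Tn]]] : exists n, {in `[- H, H], forall x, `|(u n x).2 - w x| < d} /\
    \int[mu]_(x in `]- H, H[) defect_sum n x <= e / 3 /\
    \int[mu]_(x in `]- H, H[) (`|(u n x).1 - v x| ^+ 3) <= e / 3 / l.
  have el0 : 0 < e / 3 / l by rewrite divr_gt0.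
  apply: (@filter_ex _ \oo); apply: filterI; first exact: u2_cvg.
  apply: filterI.
    move/cvgrPdist_le/(_ _ e30) : defect_sum_cvg0; apply: filterS => n.
    by rewrite sub0r normrN; apply: le_trans; exact: ler_norm.
  move/cvgrPdist_le/(_ _ el0) : cube_L1_cvg0; apply: filterS => n.
  by rewrite sub0r normrN; apply: le_trans; exact: ler_norm.
have iT := @integrableZl _ _ R mu _ (measurable_itv _) l _ (integrable_cube n).
have iD := defect_sum_integrable n.
have iDT := @integrableD _ _ R mu _ (measurable_itv _) _ _ iD iT.
have ic : mu.-integrable `]- H, H[ (EFin \o (fun=> (2 * M + k) * d)).
  by apply: (integrable_oo_bounded _ _ `|(2 * M + k) * d|) => // x _.
apply: (@le_trans _ _ (\int[mu]_(x in `]- H, H[) (defect_sum n x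
    + l * `|(u n x).1 - v x| ^+ 3 + (2 * M + k) * d))).
  apply: le_Rintegral.
  - exact: measurable_itv.
  - exact: integrable_norm.
  - exact: (@integrableD _ _ R mu _ (measurable_itv _) _ _ iDT ic).
  move=> x /subset_itv_oo_cc xH.
  apply: le_trans (limit_defect_le _ M d _ _ (u n x).1 (u n x).2 K0 d0 d1 (limit1_bound _ xH)
    (limit2_bound _ xH) (u2_bound n _ xH)) _.
  have h1 : `|(u n x).1 ^+ 2 + (u n x).2 ^+ 2 - 1| <= defect_sum n x by rewrite lerDr.
  have h2 : 2 * M * `|(u n x).2 - w x| <= 2 * M * d.
    by rewrite ler_wpM2l ?mulr_ge0// ltW// wn.
  rewrite -/k mulrDr mulrA [k * _ / _]mulrAC -/l [leRHS]addrAC [X in _ <= _ + X + _]mulrDl.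
  rewrite addrA; apply: lerD => //; rewrite addrA lerD2r; exact: lerD.
rewrite RintegralD; [|exact: measurable_itv|exact: iDT|exact: ic].
rewrite RintegralD; [|exact: measurable_itv|exact: iD|exact: iT].
have -> : \int[mu]_(x in `]- H, H[) (l * `|(u n x).1 - v x| ^+ 3) =
    l * \int[mu]_(x in `]- H, H[) (`|(u n x).1 - v x| ^+ 3).
  by apply: RintegralZl; [exact: measurable_itv|exact: integrable_cube].
rewrite Rintegral_cst// fine_lebesgue_measure_oo; last by rewrite ltW// gtrN.
have -> : e = e / 3 + e / 3 + e / 3 by field.
apply: lerD; first apply: lerD => //.
  by rewrite mulrC -ler_pdivlMr.
rewrite (_ : _ * (H - - H) = c * d) //; rewrite /c; ring.
Qed.

Lemma limit_unit : {ae mu, forall y : R, y \in `]- H, H[ -> enorm (v y, w y) = 1}.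
Proof.
have [iS S0] := limit_defect_L1.
have mS : measurable_fun `]- H, H[ (fun x => v x ^+ 2 + w x ^+ 2 - 1).
  by apply/measurable_EFinP; exact: measurable_int iS.
have [N [mN N0 sub]] := Rintegral_eq0_ae _ _ _ mS iS S0.
exists N; split => // y /= ny; apply: sub => /= h; apply: ny => /h /eqP.
by rewrite subr_eq0 /enorm /= => /eqP ->; rewrite sqrtr1.
Qed.

End sequence.

Theorem theorem6p1 (R : realType) (H L a : R)
  (H_gt0 : 0 < H) (L_gt0 : 0 < L) (a_bnd : 0 <= `|a| < 1)
  (eps : nat -> R) (u : nat -> R -> R * R) (C : R)
  (eps_gt0 : forall n, 0 < eps n)
  (eps_cvg0 : eps n @[n --> \oo] --> (0 : R))
  (u_adm : forall n, admissible H a (u n))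
  (u_energy : forall n, (energy H L (eps n) (u n) <= C%:E)%E) :
  exists (k : nat -> nat) (u1 u2 : R -> R),
    [/\ {homo k : m n / (m < n)%N},
        Lp_itv (- H) H 3%:E u1 /\
        (Lp_norm (- H) H 3%:E (fun y => (u (k n) y).1 - u1 y)
           @[n --> \oo] --> (0 : \bar R)%E),
        BV_space (- H) H (fun y => u1 y ^+ 3),
        forall gamma : R, 0 < gamma < 2^-1 ->
          holder_norm `[- H, H] gamma u2 \is a fin_num /\
          (holder_norm `[- H, H] gamma (fun y => (u (k n) y).2 - u2 y)
             @[n --> \oo] --> (0 : \bar R)%E) &
        {ae lebesgue_measure, forall y : R,
           y \in `]- H, H[ -> enorm (u1 y, u2 y) = 1}].
Proof.
have HH : - H < H by rewrite gtrN.
have hH : - H \in `[- H, H] by rewrite in_itv /= lexx ltW.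
(* A convergent sequence is bounded; E keeps the constants of the domination independent of n. *)
have [E epsE] : exists E, forall n, eps n <= E.
  have cv : cvgn eps by apply/cvg_ex; exists 0.
  have [E0 [_ epsE]] := cvg_seq_bounded cv.
  exists (E0 + 1) => n; rewrite (le_trans (ler_norm _))//.
  by apply: epsE => //; rewrite ltrDl.
set K := C / L + 2^-1.
have u2_holder n : {in `[- H, H] &, forall x y,
    `|(u n x).2 - (u n y).2| <= K * Num.sqrt `|x - y|}.
  exact: (second_component_holder _ _ _ _ _ _ L_gt0 (eps_gt0 n) (u_adm n) (u_energy n)).
have K0 : 0 < K by exact: (holder_constant_gt0 _ _ _ _ _ _ L_gt0 eps_gt0 u_adm u_energy).
(* The boundary value at - H plus the Hölder bound over a distance of at most 2 H. *)
pose M := `|a| + K * Num.sqrt (2 * H).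
have u2_bound n : {in `[- H, H], forall x, `|(u n x).2| <= M}.
  move=> x xH; have [_ [uH _]] := u_adm n.
  rewrite -(subrK (u n (- H)).2 (u n x).2) (le_trans (ler_normD _ _))//.
  rewrite addrC uH lerD//; have := u2_holder n _ _ xH hH; rewrite uH => /le_trans; apply.
  move: xH; rewrite in_itv /= => /andP[Hx xH].
  rewrite ler_wpM2l ?(ltW K0)// ler_wsqrtr// opprK ger0_norm; lra.
have u2_equi e : 0 < e -> exists2 d, 0 < d & forall n, {in `[- H, H] &, forall x y,
    `|x - y| < d -> `|(u n x).2 - (u n y).2| < e}.
  (* The solution d of K sqrt d = e. *)
  move=> e0; exists ((e / K) ^+ 2); first by rewrite exprn_gt0// divr_gt0.
  move=> n x y xH yH xy; apply: le_lt_trans (u2_holder n _ _ xH yH) _.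
  rewrite mulrC -ltr_pdivlMr// -(ltr_pXn2r (n := 2)) ?nnegrE ?sqrtr_ge0 ?divr_ge0 ?ltW//.
  by rewrite sqr_sqrtr.
have [k1 [w [hk1 wk1]]] := equicontinuous_selection _ _ _ (fun n x => (u n x).2)
  (fun n x xH => u2_bound n x xH) u2_equi.
pose F n x := potential (u (k1 n) x).1 (u (k1 n) x).2.
pose W n := dominating_primitive H L (eps (k1 n)) E M (u (k1 n)).
have FW n x y : - H <= x -> x <= y -> y <= H -> `|F n y - F n x| <= W n y - W n x.
  exact: (potential_dominated _ _ _ _ _ _ _ _ H_gt0 L_gt0 (eps_gt0 _) (epsE _) (u_adm _)
    (u_energy _) (u2_bound _)).
set B1 := (1 + M * (E + L^-1)) * (2 * C) + (E / 2 + 5 * M) * (2 * H).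
(* One constant for both families: [B1] bounds the dominating primitives, and the boundary term
   completes the bound on the potentials. *)
pose B := `|potential (Num.sqrt (1 - a ^+ 2)) a| + B1.
have FWB n x : - H <= x <= H -> `|F n x| <= B /\ `|W n x| <= B.
  move=> xH; split.
    exact: (potential_bound _ _ _ _ _ _ _ _ H_gt0 L_gt0 (eps_gt0 _) (epsE _) (u_adm _)
      (u_energy _) (u2_bound _) _ xH).
  have /andP[W0 WB] := dominating_primitive_bound _ _ _ _ _ _ _ _ H_gt0 L_gt0 (eps_gt0 _)
    (epsE _) (u_adm (k1 n)) (u_energy _) (u2_bound _) _ xH.
  by rewrite ger0_norm// (le_trans WB)// lerDr.
have [k2 [G [V [hk2 GV GB Gk2]]]] := helly_selection _ _ _ _ _ FW FWB.
(* Helly's extraction refines Ascoli's, and uniform convergence of the second components persists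
   along the refinement. *)
pose k n := k1 (k2 n).
have hk : {homo k : m n / (m < n)%N} by move=> m n mn; apply/hk1/hk2.
have keps : eps (k n) @[n --> \oo] --> (0 : R).
  exact: cvg_comp (increasing_cvg_infty _ hk) eps_cvg0.
have kw e : 0 < e -> \forall n \near \oo, {in `[- H, H], forall x, `|(u (k n) x).2 - w x| < e}.
  by move=> e0; exact: (increasing_cvg_infty _ hk2) (wk1 _ e0).
have FB n : {in `[- H, H], forall x, `|potential (u (k n) x).1 (u (k n) x).2| <= B}.
  by move=> x; rewrite in_itv /= => xH; have [] := FWB (k2 n) x xH.
have {}GB : {in `[- H, H], forall x, `|G x| <= B} by move=> x; rewrite in_itv; exact: GB.
have uk n := u2_bound (k n); have hku n := u2_holder (k n).
have k0 n := eps_gt0 (k n); have kE n := epsE (k n).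
have kadm n := u_adm (k n); have ken n := u_energy (k n).
exists k, (limit1 G), w; split => //.
- exact: (limit1_L3 _ _ _ _ _ _ _ _ H_gt0 L_gt0 k0 kE keps kadm ken _ _ FB GB GV Gk2).
- exact: (limit1_BV _ _ H_gt0 _ _ GB GV).
- by move=> gamma; exact: (limit2_norm_cvg _ _ _ _ _ _ _ H_gt0 L_gt0 k0 kadm ken _ kw uk hku).
- exact: (limit_unit _ _ _ _ _ _ _ _ _ H_gt0 L_gt0 k0 kE keps kadm ken _ _ _ FB GB GV Gk2 kw uk).
Qed.
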